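(* Let $k$ be a field of characteristic zero, $R=k[x_1,\ldots,x_n]$, and let $\mathbf{f}=\{f_1,\ldots,f_m\}\subset R$ be a set of distinct monomials of degree $2$. Then $\mathbf{f}$ is polarizable if and only if every induced bow tie of the associated graph $\mathcal{G}(\mathbf{f})$ is one of the following: (1) a monedge bow tie whose structural cycles are loops (i.e. both cycles are loops); (2) a path-degenerate looped bow tie. In particular, if $\mathbf{f}$ consists only of squarefree monomials (i.e. if $\mathcal{G}(\mathbf{f})$ is a simple graph), then $\mathbf{f}$ is polarizable if and only if $\mathcal{G}(\mathbf{f})$ does not have any induced bow tie.
   Context: Polarizability. For $\mathbf{f}=\{f_1,\ldots,f_m\}\subset R=k[x_1,\ldots,x_n]$, let $P\subset k[T_1,\ldots,T_m]$ be the kernel of the $k$-algebra map $k[T_1,\ldots,T_m]\to R$, $T_j\mapsto f_j$. The differential syzygy module is $\mathcal{Z}=\{(r_1,\ldots,r_m)\in R^m : \sum_{j} r_j\,\partial f_j/\partial x_i=0 \text{ for all } i=1,\ldots,n\}$. The polar syzygy module $\mathcal{P}\subset\mathcal{Z}$ is the $R$-submodule of $R^m$ generated by the vectors $\left(\frac{\partial F}{\partial T_1}(\mathbf{f}),\ldots,\frac{\partial F}{\partial T_m}(\mathbf{f})\right)$, $F\in P$. The set $\mathbf{f}$ is polarizable if $\mathcal{P}=\mathcal{Z}$. Graph. $\mathcal{G}(\mathbf{f})$ is the graph (with loops allowed) with vertices $x_1,\ldots,x_n$ and an edge joining $x_i$ and $x_j$ ($i\le j$; a loop if $i=j$) exactly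 when $x_ix_j\in\mathbf{f}$. Bow ties. An odd cycle is a cycle of odd length $\geq 3$ or a loop (a cycle of length $1$). A bow tie is a connected subgraph consisting of two odd cycles (the structural cycles) with no common edge joined by a connecting (structural) path: either the two cycles have disjoint vertex sets and the path, of length $\ge 1$, goes from a vertex of one cycle to a vertex of the other, having no other vertex in common with the cycles; or the path degenerates into a single vertex, i.e. the two cycles have exactly one vertex in common, and then the bow tie is called path-degenerate. Either cycle may be a loop (in a path-degenerate bow tie, not both); if at least one is a loop the bow tie is called looped. A monedge bow tie is one whose connecting path consists of one single edge. Induced. A subgraph of $\mathcal{G}(\mathbf{f})$ is induced if it is obtained by deleting a set of vertices together with all the edges through them and/or deleting a set of loops (leaving the base vertex of the loop). Thus a bow tie is induced if every non-loop edge of $\mathcal{G}(\mathbf{f})$ joining two of its vertices belongs to it; extra loops at its vertices are permitted. *)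

(* Defs.v *)
From mathcomp Require Import all_boot all_order all_algebra.
From mathcomp Require Export mpoly.

Set Implicit Arguments.
Unset Strict Implicit.
Unset Printing Implicit Defensive.

Import GRing.Theory.
Local Open Scope ring_scope.

(* The submodule generated by G, as the set of finite linear combinations. *)
Definition submod_gen (A : pzRingType) (M : lmodType A) (G : M -> Prop)
    (v : M) : Prop :=
  exists2 s : seq (A * M),
    (forall c, c \in s -> G c.2) & v = \sum_(c <- s) c.1 *: c.2.

Section Polarizability.
Variables (k : fieldType) (n m : nat) (f : m.-tuple {mpoly k[n]}).

Definition presentation_ideal (F : {mpoly k[m]}) : Prop := F \mPo f = 0.

Definition diff_syzygy (r : 'rV[{mpoly k[n]}]_m) : Prop :=
  forall i : 'I_n, \sum_(j < m) r 0 j * (tnth f j)^`M(i) = 0.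

Definition gradient_at (F : {mpoly k[m]}) : 'rV[{mpoly k[n]}]_m :=
  \row_(j < m) (F^`M(j) \mPo f).

Definition polar_syzygy : 'rV[{mpoly k[n]}]_m -> Prop :=
  submod_gen (fun v => exists2 F, presentation_ideal F & v = gradient_at F).

Definition polarizable : Prop := forall v, polar_syzygy v <-> diff_syzygy v.

End Polarizability.

Section Monomials.
Variables (k : fieldType) (n : nat).

Definition monomial_of_degree (d : nat) (g : {mpoly k[n]}) : Prop :=
  exists2 mu : 'X_{1..n}, mdeg mu = d & g = 'X_[mu].

Definition squarefree_monomial (g : {mpoly k[n]}) : Prop :=
  exists2 mu : 'X_{1..n}, (forall i, (mu i <= 1)%N) & g = 'X_[mu].

End Monomials.

(* An edge is the set of its endpoints: {x, y} with x != y for an ordinary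
   edge, the singleton {x} = [set x; x] for the loop at x. *)
Record graph (T : finType) := Graph {
  vertices : {set T};
  edges : {set {set T}}
}.

Section Graphs.
Variable T : finType.
Implicit Types (G H : graph T) (c : seq T).

Definition loops G : {set {set T}} := [set E in edges G | #|E| == 1%N].

Definition simple_graph G : Prop := loops G = set0.

(* Delete the vertices in D with all the edges through them, then the loops
   in L. *)
Definition delete G (D : {set T}) (L : {set {set T}}) : graph T :=
  Graph (vertices G :\: D) ([set E in edges G | [disjoint E & D]] :\: L).

Definition induced_subgraph H G : Prop :=
  exists D : {set T},
  exists2 L : {set {set T}}, L \subset loops G & H = delete G D L.

(* A cycle is given by its vertices in cyclic order; [next c x] wraps around,
   so that [:: x] is the loop at x. *)
Definition cycle_edges c : {set {set T}} := [set [set x; next c x] | x in c].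

Definition odd_cycle c : bool := uniq c && odd (size c).

Definition is_loop c : bool := size c == 1%N.

(* The path visiting x, then the vertices of p in order. *)
Definition path_edges (x : T) (p : seq T) : {set {set T}} :=
  [set [set a.1; a.2] | a in zip (x :: p) p].

(* The path runs from bt_start through the vertices of bt_path; its length is
   size bt_path.  The requirement that the cycles have no common edge excludes
   two loops in the path-degenerate case. *)
Record bow_tie := BowTie {
  bt_cycle1 : seq T;
  bt_cycle2 : seq T;
  bt_start : T;
  bt_path : seq T;
  bt_end := last bt_start bt_path;
  bt_odd1 : odd_cycle bt_cycle1;
  bt_odd2 : odd_cycle bt_cycle2;
  bt_edge_disjoint : [disjoint cycle_edges bt_cycle1 & cycle_edges bt_cycle2];
  bt_shape :
    [/\ [disjoint bt_cycle1 & bt_cycle2],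
        uniq (bt_start :: bt_path) /\ (0 < size bt_path)%N,
        bt_start \in bt_cycle1 /\ bt_end \in bt_cycle2
      & forall z, z \in bt_start :: bt_path -> z \in bt_cycle1 ++ bt_cycle2 ->
          z = bt_start \/ z = bt_end]
    \/ bt_path = [::] /\
       (forall z, (z \in bt_cycle1) && (z \in bt_cycle2) = (z == bt_start))
}.

Definition bow_tie_graph (B : bow_tie) : graph T :=
  Graph [set x in bt_cycle1 B ++ bt_cycle2 B ++ bt_start B :: bt_path B]
        (cycle_edges (bt_cycle1 B) :|: cycle_edges (bt_cycle2 B)
           :|: path_edges (bt_start B) (bt_path B)).

Definition path_degenerate (B : bow_tie) : Prop := bt_path B = [::].

Definition monedge (B : bow_tie) : Prop := size (bt_path B) = 1%N.

Definition looped (B : bow_tie) : Prop :=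
  is_loop (bt_cycle1 B) \/ is_loop (bt_cycle2 B).

Definition both_loops (B : bow_tie) : Prop :=
  is_loop (bt_cycle1 B) /\ is_loop (bt_cycle2 B).

End Graphs.

Definition monomial_graph (k : fieldType) (n m : nat)
    (f : m.-tuple {mpoly k[n]}) : graph 'I_n :=
  Graph [set: 'I_n]
        [set [set e.1; e.2] | e : 'I_n * 'I_n & 'X_e.1 * 'X_e.2 \in f].

(* Main.v *)
Require Import Defs.
From mathcomp Require Import all_boot all_order all_algebra.
From mathcomp Require Import ring zify.

(** Both syzygy modules are graded by the monomials of R. Let f_j have exponent
    a_j, and let v be a row all of whose products v_j f_j are multiples c_j x^u of
    one monomial. Multiplying the i-th equation by x_i shows that v is a
    differential syzygy exactly when the sum of the c_j a_j is 0. On the polar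
    side, P is spanned by binomials T^al - T^be with f^al = f^be, and such a
    binomial contributes the relation c = al - be in every degree u divisible by
    f^al. In each degree two finite-dimensional spaces have to be compared, and
    linear duality turns this into a statement about weights ([polarizableP]):
    f is polarizable iff, for every u, each weight w on the indices j which takes
    the same value on al and be whenever f^al = f^be divides x^u vanishes on all
    linear relations between the a_j with f_j dividing x^u.

    For quadratic monomials the f_j dividing x^u are the edges of a subgraph of
    G(f), and w is a weight on these edges. The alternating sum of w along a
    closed even walk is w(al) - w(be) with f^al = f^be the product of the visited
    vertices, so it vanishes if every vertex v is visited at most u_v times. If it
    vanishes along all closed even walks, then w(xy) = g(x) + g(y) for a function
    g on the vertices ([potential]), and such a w kills every linear relation.
    Take a shortest closed even walk along which the sum is not 0. It visits some
    vertex twice, hence is a product of two odd closed walks; more generally one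
    looks at dumbbells, that is, two odd closed walks joined by a handle, which is
    traversed back and forth. Among the dumbbells of minimal length with non-zero
    sum take one with the longest handle. Two walks with the same ends, the same
    parity and small total length have equal sums ([eq_altsum]); this forces the
    sum to vanish as soon as the dumbbell repeats a vertex or has a chord, so it
    is an induced bow tie ([extremal_bow_tie]). In a bow tie of one of the two
    allowed types no vertex is visited more than u_v times: contradiction
    ([balanced], [weight_orthogonal]).

    Conversely, an induced bow tie of any other type has a vertex v on its
    structural path at which it has no loop. Let u be the least common multiple
    of its edges, so that u_v = 1, and let S be one of the two sides of v. If
    f^al divides x^u, then T^al involves at most one edge between S and v, and
    the parity of the number of such edges is the parity of the degree of f^al in
    the vertices of S. Hence the number of these edges is a weight as above. But
    it takes the value 2 on the alternating relation carried by the closed even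
    walk around the bow tie, so f is not polarizable
    ([pinch_not_polarizable]). *)

Set Implicit Arguments.
Unset Strict Implicit.
Unset Printing Implicit Defensive.

Import GRing.Theory.
Local Open Scope ring_scope.

(** * Alternating sums along walks *)

Ltac case_odd := repeat match goal with |- context [odd ?n] => case: (odd n) end.

Section AlternatingSums.
Variables (T : Type) (K : fieldType).
Implicit Types (h : T -> T -> K) (x y : T) (p q : seq T).

Fixpoint altsum h x p : K :=
  if p is y :: p' then h x y - altsum h y p' else 0.

(** A walk is given by its first vertex x and the list p of the following ones;
    [back x p] follows the same walk in the opposite direction, from [last x p]
    down to x. *)
Definition back x p := rev (belast x p).

Lemma size_back x p : size (back x p) = size p.
Proof. by rewrite size_rev size_belast. Qed.

Lemma last_back x p : last (last x p) (back x p) = x.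
Proof. by case: p => [|y p] //=; rewrite /back /= rev_cons last_rcons. Qed.

Lemma back_cat x p q : back x (p ++ q) = back (last x p) q ++ back x p.
Proof. by rewrite /back belast_cat rev_cat. Qed.

Lemma altsum_cat h x p q :
  altsum h x (p ++ q) = altsum h x p + (-1) ^+ size p * altsum h (last x p) q.
Proof.
elim: p x => [|y p IH] x /=; first by rewrite expr0 mul1r add0r.
by rewrite IH exprS; ring.
Qed.

Lemma altsum_back h x p : (forall y z, h y z = h z y) ->
  altsum h (last x p) (back x p) = - (-1) ^+ size p * altsum h x p.
Proof.
move=> hC; elim: p x => [|y p IH] x; first by rewrite /= mulr0.
rewrite -cat1s back_cat altsum_cat size_back last_cat last_back.
rewrite IH altsum_cat size_cat exprD /= hC.
by rewrite -signr_odd; case: odd; ring.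
Qed.

(** The values g(y) at the inner vertices y cancel in pairs. *)
Lemma altsum_potential h (g : T -> K) x p : (forall y z, h y z = g y + g z) ->
  altsum h x p = g x - (-1) ^+ size p * g (last x p).
Proof.
move=> hg; elim: p x => [|y p IH] x /=; first by rewrite mul1r subrr.
by rewrite IH hg exprS; ring.
Qed.

Lemma altsum_eq_in (e : rel T) h h' x p :
  (forall y z, e y z -> h y z = h' y z) -> path e x p -> altsum h x p = altsum h' x p.
Proof. by move=> hh; elim: p x => [//|y p IH] x /= /andP[/hh-> /IH ->]. Qed.

Lemma altsum0 x p : altsum (fun _ _ => 0) x p = 0.
Proof. by elim: p x => [//|y p IH] x /=; rewrite IH subrr. Qed.

Lemma altsum_sum (I : finType) (r : I -> K) (H : I -> T -> T -> K) x p :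
  \sum_i r i * altsum (H i) x p = altsum (fun y z => \sum_i r i * H i y z) x p.
Proof.
elim: p x => [|y p IH] x /=; first by rewrite big1 // => i _; rewrite mulr0.
by rewrite -IH -sumrB; apply: eq_bigr => i _; rewrite mulrBr.
Qed.

End AlternatingSums.

Lemma path_back (T : Type) (e : rel T) x p : (forall y z, e y z = e z y) ->
  path e (last x p) (back x p) = path e x p.
Proof. by move=> eC; rewrite rev_path; apply: eq_path => y z; rewrite eC. Qed.

(** * Dumbbells of minimal length *)

Section Dumbbells.
Variables (T : eqType) (K : fieldType) (e : rel T) (h : T -> T -> K).
Hypotheses (eC : (forall y z, e y z = e z y)) (hC : forall x y, h x y = h y x).
Implicit Types (x y : T) (p q r A : seq T).
Local Notation alt := (altsum h).
Local Notation sg n := ((-1 : K) ^+ n).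

Definition balanced_below N := forall x p, path e x p -> last x p = x ->
  ~~ odd (size p) -> (size p < N)%N -> alt x p = 0.

Definition odd_closed x p := [&& path e x p, last x p == x & odd (size p)].

Definition dumbbell x o1 A o2 : bool :=
  [&& odd_closed x o1, path e x A & odd_closed (last x A) o2].

(** The handle counts twice: it is the length of the closed walk
    [o1 ++ A ++ o2 ++ back x A]. *)
Definition dumbbell_length (o1 A o2 : seq T) : nat :=
  size o1 + size o2 + (size A).*2.

(** The alternating sum along the closed walk [o1 ++ A ++ o2 ++ back x A], see
    [defect_walk]. *)
Definition defect x o1 A o2 : K :=
  alt x o1 - 2%:R * alt x A - sg (size A) * alt (last x A) o2.

Lemma sgP n : sg n = if odd n then -1 else 1.
Proof. by rewrite -signr_odd; case: (odd n). Qed.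

(** Going along p and back along q is a closed even walk. This is the tool for
    all shortcut arguments below. *)
Lemma eq_altsum N x p q : balanced_below N -> path e x p -> path e x q ->
  last x p = last x q -> odd (size p) = odd (size q) ->
  (size p + size q < N)%N -> alt x p = alt x q.
Proof.
move=> bal ep eq l o s; apply/eqP; rewrite -subr_eq0; apply/eqP.
have := bal x (p ++ back x q); rewrite cat_path ep l path_back // eq.
rewrite last_cat l last_back size_cat size_back oddD o addbb.
move=> /(_ isT erefl isT s); rewrite altsum_cat l altsum_back // => <-.
rewrite !sgP o; case: ifP => _; ring.
Qed.

Lemma odd_closed_back x p : odd_closed x p -> odd_closed x (back x p).
Proof.
case/and3P=> ep /eqP l o; apply/and3P; split; last by rewrite size_back.
  by rewrite -{1}l path_back.
by rewrite -{1}l last_back.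
Qed.

Lemma altsum_odd_back x p : odd_closed x p -> alt x (back x p) = alt x p.
Proof.
by case/and3P=> _ /eqP l o; rewrite -{1}l altsum_back // sgP o opprK mul1r.
Qed.

Lemma dumbbell_flip x o1 A o2 :
  dumbbell x o1 A o2 -> dumbbell (last x A) o2 (back x A) o1.
Proof. by case/and3P=> *; apply/and3P; rewrite last_back path_back. Qed.

Lemma defect_flip x o1 A o2 :
  defect (last x A) o2 (back x A) o1 = - sg (size A) * defect x o1 A o2.
Proof.
rewrite /defect last_back size_back altsum_back // sgP; case: ifP => _; ring.
Qed.

Lemma dumbbell_back1 x o1 A o2 :
  dumbbell x o1 A o2 -> dumbbell x (back x o1) A o2.
Proof. by case/and3P=> ? ? ?; apply/and3P; rewrite odd_closed_back. Qed.

Lemma defect_back1 x o1 A o2 :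
  dumbbell x o1 A o2 -> defect x (back x o1) A o2 = defect x o1 A o2.
Proof. by case/and3P=> ? _ _; rewrite /defect altsum_odd_back. Qed.

Lemma dumbbell_walk x o1 A o2 : dumbbell x o1 A o2 ->
  let p := o1 ++ A ++ o2 ++ back x A in
  [/\ path e x p, last x p = x, ~~ odd (size p) & size p = dumbbell_length o1 A o2].
Proof.
case/and3P=> /and3P[p1 /eqP l1 d1] pA /and3P[p2 /eqP l2 d2] /=.
rewrite !cat_path p1 l1 pA p2 l2 path_back // pA !last_cat l1 l2 last_back.
rewrite !size_cat size_back !oddD d1 d2 /= addbN addbb; split=> //.
by rewrite /dumbbell_length; lia.
Qed.

Lemma defect_walk x o1 A o2 : dumbbell x o1 A o2 ->
  alt x (o1 ++ A ++ o2 ++ back x A) = defect x o1 A o2.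
Proof.
case/and3P=> /and3P[p1 /eqP l1 d1] pA /and3P[p2 /eqP l2 d2].
rewrite !altsum_cat l1 l2 altsum_back // /defect !sgP d1 d2; case: ifP => _; ring.
Qed.

Lemma short_dumbbell N x o1 A o2 : balanced_below N -> dumbbell x o1 A o2 ->
  (dumbbell_length o1 A o2 < N)%N -> defect x o1 A o2 = 0.
Proof.
move=> bal db lt; have [ep lp op sp] := dumbbell_walk db.
by rewrite -defect_walk //; apply: bal => //; rewrite sp.
Qed.

(* The hypotheses on paths, parities and sums only slow down arithmetic on the
   lengths of walks. *)
Ltac size_lia :=
  repeat match goal with
  | H : is_true (path _ _ _) |- _ => clear H
  | H : is_true (odd_closed _ _ _) |- _ => clear H
  | H : is_true (odd _) |- _ => clear H
  | H : is_true (odd _ (+) odd _) |- _ => clear H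
  | H : is_true (odd _ != odd _) |- _ => clear H
  | H : odd _ = odd _ |- _ => clear H
  | H : last _ _ = _ |- _ => clear H
  | H : altsum _ _ _ = _ |- _ => clear H
  | H : balanced_below _ _ _ |- _ => clear H
  end;
  rewrite ?size_cat ?size_back; lia.

Section Chords.
Variables (N : nat).
Hypothesis bal : balanced_below N.

(** A walk of length at most 1: the link of length 0 expresses y = z, the link of
    length 1 an edge from y to z. Repeated vertices and chords are thus treated
    together. *)
Definition link y r z := [&& path e y r, last y r == z & (size r <= 1)%N].

Lemma link_back y r z : link y r z -> link z (back y r) y.
Proof.
by case/and3P=> er /eqP <- s; rewrite /link path_back // er last_back size_back eqxx.
Qed.

(** If the shortcut r has the parity of the part M of the handle, replacing M by r
    gives a shorter dumbbell with the same defect. Otherwise r has the parity of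
    both walks from y to z that leave the handle at M, one turning around in o2
    and the other one in o1; comparing both with r kills the defect. *)
Lemma handle_chord x o1 A1 M A2 o2 r :
    dumbbell x o1 (A1 ++ M ++ A2) o2 ->
    dumbbell_length o1 (A1 ++ M ++ A2) o2 = N ->
    link (last x A1) r (last (last x A1) M) -> (size r < size M)%N ->
  defect x o1 (A1 ++ M ++ A2) o2 = 0.
Proof.
rewrite /dumbbell !cat_path !last_cat.
set y := last x A1; set z := last y M; set w := last z A2.
case/and3P=> c1 /and3P[pA1 pM pA2] c2; rewrite /dumbbell_length !size_cat => len.
case/and3P=> pr /eqP lr sr srM.
case/and3P: (c1) => p1 /eqP l1 d1; case/and3P: (c2) => p2 /eqP l2 d2.
have [s1 s2] := (odd_gt0 d1, odd_gt0 d2).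
have [oMr|oMr] := eqVneq (odd (size M)) (odd (size r)).
  have eqM : alt y M = alt y r by apply: (eq_altsum bal) => //; size_lia.
  have <- : defect x o1 (A1 ++ r ++ A2) o2 = defect x o1 (A1 ++ M ++ A2) o2.
    rewrite /defect !last_cat -/y lr !altsum_cat -/y lr eqM !size_cat !exprD.
    by rewrite (sgP (size M)) (sgP (size r)) oMr.
  apply: (short_dumbbell bal) => //.
    by rewrite /dumbbell !cat_path !last_cat c1 pA1 pr lr pA2.
  by rewrite /dumbbell_length; size_lia.
have eq1 : alt y (M ++ A2 ++ o2 ++ back z A2) = alt y r.
  apply: (eq_altsum bal) => //.
  - by rewrite !cat_path pM pA2 p2 l2 path_back.
  - by rewrite !last_cat l2 last_back lr.
  - by rewrite !size_cat size_back !oddD d2; move: oMr; case_odd.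
  by size_lia.
have eq2 : alt y (back x A1 ++ o1 ++ A1 ++ M) = alt y r.
  apply: (eq_altsum bal) => //.
  - by rewrite !cat_path path_back // last_back p1 l1 pA1.
  - by rewrite !last_cat last_back l1 lr.
  - by rewrite !size_cat size_back !oddD d1; move: oMr; case_odd.
  by size_lia.
have : sg (size A1) * (alt y (back x A1 ++ o1 ++ A1 ++ M) -
    alt y (M ++ A2 ++ o2 ++ back z A2)) = 0 by rewrite eq1 eq2 subrr mulr0.
move=> <-; rewrite !altsum_cat l2 last_back l1 /y !altsum_back // -/y -/z.
rewrite size_back /defect !altsum_cat !last_cat !size_cat !exprD -/y -/z -/w.
by rewrite !sgP d1 d2; do 3!case: ifP => _; ring.
Qed.

(** The link r between o1 and the handle splits the closed walk of the dumbbell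
    into two walks from y to v; under the parity hypothesis both have the parity
    of r, so they have the same sum. *)
Lemma cycle_handle_link x p q A1 A2 o2 r :
    dumbbell x (p ++ q) (A1 ++ A2) o2 ->
    dumbbell_length (p ++ q) (A1 ++ A2) o2 = N ->
    link (last x p) r (last x A1) -> (0 < size p)%N ->
    odd (size q + size A1) = odd (size r) -> (size r < size q + size A1)%N ->
  defect x (p ++ q) (A1 ++ A2) o2 = 0.
Proof.
rewrite /dumbbell /odd_closed !cat_path !last_cat.
set y := last x p; set v := last x A1; set w := last v A2.
case/and3P=> /and3P[/andP[pp pq] /eqP lq d1] /andP[pA1 pA2] /and3P[p2 /eqP l2 d2].
rewrite /dumbbell_length !size_cat => len /and3P[pr /eqP lr sr] p0 oqr sq.
rewrite size_cat oddD in d1; have s2 := odd_gt0 d2.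
have eq1 : alt y (q ++ A1) = alt y r.
  apply: (eq_altsum bal) => //; rewrite ?cat_path ?last_cat ?lq ?pq ?size_cat //.
  by size_lia.
have eq2 : alt y (back x p ++ A1 ++ A2 ++ o2 ++ back v A2) = alt y r.
  apply: (eq_altsum bal) => //.
  - by rewrite !cat_path path_back // last_back pp pA1 pA2 p2 l2 path_back.
  - by rewrite !last_cat last_back l2 last_back lr.
  - by rewrite -oqr !size_cat !size_back !oddD d2; move: d1; case_odd.
  by size_lia.
have : sg (size p) * (alt y (q ++ A1) -
    alt y (back x p ++ A1 ++ A2 ++ o2 ++ back v A2)) = 0.
  by rewrite eq1 eq2 subrr mulr0.
move=> <-; rewrite !altsum_cat last_back l2 lq /y /w !altsum_back // -/y -/w -/v.
rewrite size_back /defect !altsum_cat !last_cat !size_cat !exprD -/y -/v -/w.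
by rewrite !sgP d2; move: d1; case: (odd (size p)) => /= [/negbTE|] ->;
  do 2!case: (odd _); ring.
Qed.

(** As o1 is odd, the two arcs of o1 have different parities, and after reversing
    o1 if necessary the parity hypothesis of [cycle_handle_link] holds. *)
Lemma cycle_handle_link_lt x p q A1 A2 o2 r :
    dumbbell x (p ++ q) (A1 ++ A2) o2 ->
    dumbbell_length (p ++ q) (A1 ++ A2) o2 = N ->
    link (last x p) r (last x A1) -> (0 < size p)%N -> (0 < size q)%N ->
    (size r < size q + size A1)%N -> (size r < size p + size A1)%N ->
  defect x (p ++ q) (A1 ++ A2) o2 = 0.
Proof.
move=> db len lk p0 q0 rq rp.
have [oqr|oqr] := eqVneq (odd (size q + size A1)) (odd (size r)).
  exact: cycle_handle_link lk _ _ _.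
rewrite -defect_back1 //.
case/and3P: (db) => /and3P[_ /eqP lx o1] _ _.
move: (dumbbell_back1 db) len lx lk; rewrite back_cat last_cat.
move=> db' len lx lk.
apply: (cycle_handle_link (r := r)) => //; rewrite ?size_back //.
- by move: len; rewrite /dumbbell_length; size_lia.
- by rewrite -{1}lx last_back.
by move: o1 oqr; rewrite size_cat !oddD; case_odd.
Qed.

(** Going from x to the other end of the handle through the link is possible along
    four combinations of arcs of o1 and o2. Two of them have the parity of the
    handle, and they use each arc exactly once; both have the sum of the handle,
    and adding up the two equations gives the defect. *)
Lemma cycle_cycle_link x p q A p2 q2 r :
    dumbbell x (p ++ q) A (p2 ++ q2) ->
    dumbbell_length (p ++ q) A (p2 ++ q2) = N ->
    link (last x p) r (last (last x A) p2) ->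
    [&& (0 < size p), (0 < size q), (0 < size p2) & (0 < size q2)]%N ->
    odd (size p + size r + size q2) = odd (size A) ->
  defect x (p ++ q) A (p2 ++ q2) = 0.
Proof.
rewrite /dumbbell /odd_closed !cat_path !last_cat.
set y := last x p; set z := last x A; set w := last z p2.
case/and3P=> /and3P[/andP[pp pq] /eqP lq d1] pA /and3P[/andP[pp2 pq2] /eqP lq2 d2].
rewrite /dumbbell_length !size_cat => len /and3P[pr /eqP lr sr] /and4P[p0 q0 p20 q20].
move=> oA; rewrite size_cat oddD in d1; rewrite size_cat oddD in d2.
rewrite !oddD in oA.
have lbq : last x (back y q) = y by rewrite -{1}lq last_back.
have abq : alt x (back y q) = - sg (size q) * alt y q by rewrite -{1}lq altsum_back.
have eq1 : alt x (p ++ r ++ q2) = alt x A.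
  apply: (eq_altsum bal) => //.
  - by rewrite !cat_path pp pr lr.
  - by rewrite !last_cat -/y lr.
  - by rewrite !size_cat !oddD addbA.
  by size_lia.
have eq2 : alt x (back y q ++ r ++ back z p2) = alt x A.
  apply: (eq_altsum bal) => //.
  - by rewrite !cat_path lbq lr !path_back // -{1}lq path_back // pq pr.
  - by rewrite !last_cat lbq lr last_back.
  - by move: d1 d2; rewrite -oA !size_cat !size_back !oddD; case_odd.
  by size_lia.
have : (alt x (p ++ r ++ q2) - alt x A) +
    (alt x (back y q ++ r ++ back z p2) - alt x A) = 0.
  by rewrite eq1 eq2 !subrr addr0.
move=> <-; rewrite /defect !altsum_cat -/y -/z -/w lbq lr abq.
rewrite !altsum_back // !size_back !sgP -oA.
by move: d1 d2; do 5![case: (odd _) => //=] => _ _; ring.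
Qed.

Lemma cycle_cycle_no_link x p q A p2 q2 r :
    dumbbell x (p ++ q) A (p2 ++ q2) ->
    dumbbell_length (p ++ q) A (p2 ++ q2) = N ->
    link (last x p) r (last (last x A) p2) ->
    [&& (0 < size p), (0 < size q), (0 < size p2) & (0 < size q2)]%N ->
  defect x (p ++ q) A (p2 ++ q2) = 0.
Proof.
move=> db len lk /and4P[p0 q0 p20 q20].
have [oA|oA] := eqVneq (odd (size p + size r + size q2)) (odd (size A)).
  by apply: cycle_cycle_link lk _ oA; rewrite // p0 q0 p20.
have eqb : defect x (p ++ q) A (back (last x A) (p2 ++ q2)) =
    defect x (p ++ q) A (p2 ++ q2).
  by case/and3P: db => _ _ c2; rewrite /defect altsum_odd_back.
case/and3P: (db) => c1 pA c2; case/and3P: (c2) => _ /eqP lz o2.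
move: eqb (odd_closed_back c2) lz; rewrite back_cat last_cat.
move=> <- c2' lz.
apply: (cycle_cycle_link (r := r)); rewrite ?size_back ?p0 ?q0 ?p20 ?q20 //.
- by apply/and3P.
- by move: len; rewrite /dumbbell_length; size_lia.
- suff -> : last (last x A) (back (last (last x A) p2) q2) = last (last x A) p2 by [].
  by rewrite -{1}lz last_back.
by move: o2 oA; rewrite size_cat !oddD; case_odd.
Qed.

(** A chord that cuts off an even closed walk can replace the arc q. *)
Lemma cycle_chord_even x p q p' A o2 r :
    dumbbell x (p ++ q ++ p') A o2 -> dumbbell_length (p ++ q ++ p') A o2 = N ->
    link (last x p) r (last (last x p) q) -> (0 < size p)%N ->
    odd (size q) = odd (size r) -> (size r < size q)%N ->
  defect x (p ++ q ++ p') A o2 = 0.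
Proof.
rewrite /dumbbell /odd_closed !cat_path !last_cat.
set y := last x p; set z := last y q.
case/and3P=> /and3P[/and3P[pp pq pp'] /eqP lp' d1] pA c2.
rewrite /dumbbell_length !size_cat => len /and3P[pr /eqP lr sr] p0 oqr sq.
case/and3P: (c2) => _ _ /odd_gt0 s2.
have eqM : alt y q = alt y r by apply: (eq_altsum bal) => //; size_lia.
have <- : defect x (p ++ r ++ p') A o2 = defect x (p ++ q ++ p') A o2.
  by rewrite /defect !altsum_cat -/y lr eqM (sgP (size q)) oqr -sgP.
apply: (short_dumbbell bal) => //.
  rewrite /dumbbell /odd_closed !cat_path !last_cat -/y lr pp pr pp' lp' eqxx pA c2.
  by move: d1; rewrite !size_cat !oddD oqr => ->.
by rewrite /dumbbell_length; size_lia.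
Qed.

(** Maximality of the handle length a among the dumbbells of length N with
    non-zero defect. *)
Definition longer_handles_vanish a := forall x o1 A o2, dumbbell x o1 A o2 ->
  dumbbell_length o1 A o2 = N -> (a < size A)%N -> defect x o1 A o2 = 0.

(** The chord r closes the arc q to a smaller odd closed walk at y. Prolonging the
    handle by p up to y gives a dumbbell with the same defect up to sign, since p
    and the detour over p' and r have equal sums; by the hypothesis on the
    lengths this dumbbell is shorter, or has the same length and a longer
    handle. *)
Lemma cycle_chord_odd x p q p' A o2 r : longer_handles_vanish (size A) ->
    dumbbell x (p ++ q ++ p') A o2 -> dumbbell_length (p ++ q ++ p') A o2 = N ->
    link (last x p) r (last (last x p) q) -> (0 < size q)%N ->
    odd (size q) != odd (size r) ->
    (size p + size r < size p')%N ||
    (size p + size r <= size p')%N && (0 < size p)%N ->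
  defect x (p ++ q ++ p') A o2 = 0.
Proof.
rewrite /dumbbell /odd_closed !cat_path !last_cat.
set y := last x p; set z := last y q => longer.
case/and3P=> /and3P[/and3P[pp pq pp'] /eqP lp' d1] pA c2.
rewrite /dumbbell_length !size_cat => len lk q0 oqr sp.
case/and3P: (lk) => pr /eqP lr sr; case/and3P: (link_back lk) => pr' /eqP lr' _.
case/and3P: (c2) => _ _ /odd_gt0 s2; rewrite !size_cat !oddD in d1.
have lbp : last x (back z p') = z by rewrite -{1}lp' last_back.
have abp : alt x (back z p') = - sg (size p') * alt z p'.
  by rewrite -{1}lp' altsum_back.
have eqp : alt x p = alt x (back z p' ++ back y r).
  apply: (eq_altsum bal) => //.
  - by rewrite cat_path lbp -{1}lp' path_back // pp' pr'.
  - by rewrite last_cat lbp lr'.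
  - by move: d1 oqr; rewrite size_cat !size_back !oddD; case_odd.
  by size_lia.
have <- : sg (size p) * defect y (q ++ back y r) (back x p ++ A) o2 =
    defect x (p ++ q ++ p') A o2.
  apply: subr0_eq.
  transitivity (alt x p - alt x (back z p' ++ back y r)); last by rewrite eqp subrr.
  rewrite /defect !altsum_cat !last_cat last_back !altsum_back // -/y -/z.
  rewrite lbp abp size_cat !size_back exprD !sgP.
  by move: d1 oqr; do 5![case: (odd _) => //=] => _ _; ring.
have db : dumbbell y (q ++ back y r) (back x p ++ A) o2.
  rewrite /dumbbell /odd_closed !cat_path !last_cat last_back pA c2 path_back // pp.
  rewrite pq pr' lr' eqxx size_cat size_back oddD.
  by move: oqr; case_odd.
have [lt|ge] := ltnP (dumbbell_length (q ++ back y r) (back x p ++ A) o2) N.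
  by rewrite (short_dumbbell bal db lt) mulr0.
rewrite (longer _ _ _ _ db) ?mulr0 //; move: ge; rewrite /dumbbell_length.
  by size_lia.
by size_lia.
Qed.

(** The excluded case is the edge of o1 that closes it up at x. *)
Lemma cycle_chord x p q p' A o2 r : longer_handles_vanish (size A) ->
    dumbbell x (p ++ q ++ p') A o2 -> dumbbell_length (p ++ q ++ p') A o2 = N ->
    link (last x p) r (last (last x p) q) ->
    (0 < size p)%N -> (size r < size q)%N ->
    ~~ [&& size r == 1, size p == 1 & size p' == 0]%N ->
  defect x (p ++ q ++ p') A o2 = 0.
Proof.
move=> longer db len lk p0 sq not_edge.
have [oqr|oqr] := eqVneq (odd (size q)) (odd (size r)).
  exact: cycle_chord_even lk _ _ _.
have [le|gt] := leqP (size p + size r) (size p').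
  by apply: cycle_chord_odd lk _ oqr _ => //; rewrite ?le ?p0 ?orbT //; size_lia.
have o1 : odd (size (p ++ q ++ p')) by case/and3P: db => /and3P[].
have lt : (size p' + size r < size p)%N ||
    (size p' + size r <= size p)%N && (0 < size p')%N.
  have : (size r <= 1)%N by case/and3P: lk.
  move: o1 oqr gt not_edge p0 sq; rewrite !size_cat !oddD; clear.
  move: (size p) (size q) (size r) (size p') => a b [|[|//]] c; lia.
rewrite -defect_back1 //.
case/and3P: (db) => /and3P[_ /eqP lx _] _ _.
move: (dumbbell_back1 db) len lx (link_back lk) lt.
rewrite !back_cat !last_cat -!catA => db' len lx lk' lt.
apply: (cycle_chord_odd (r := back (last x p) r)) => //; rewrite ?size_back //.
- by move: len; rewrite /dumbbell_length; size_lia.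
- suff -> : last x (back (last (last x p) q) p') = last (last x p) q.
    by rewrite last_back.
  by rewrite -{1}lx last_back.
by size_lia.
Qed.

End Chords.
End Dumbbells.

(** * Edges of paths and cycles *)

Section SeqSplit.
Variable T : eqType.
Implicit Types (s a b c : seq T) (x y z : T).

Lemma not_uniq_split s : ~~ uniq s -> exists y a b c, s = a ++ y :: b ++ y :: c.
Proof.
elim: s => [//|x s IH] /=; rewrite negb_and negbK => /orP[|/IH].
  by case/splitPr=> b c; exists x, [::], b, c.
by case=> y [a [b [c ->]]]; exists y, (x :: a), b, c.
Qed.

Lemma two_mem_split s y z : y \in s -> z \in s -> y != z ->
  exists a b c, s = a ++ y :: b ++ z :: c \/ s = a ++ z :: b ++ y :: c.
Proof.
case/splitPr=> a b; rewrite mem_cat inE eq_sym => /or3P[|->//|].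
  by case/splitPr=> a1 a2 _; exists a1, a2, b; right; rewrite -catA.
by case/splitPr=> b1 b2 _; exists a, b1, b2; left.
Qed.

Lemma cons_split x s a y b : x :: s = a ++ y :: b ->
  exists2 s1, s = s1 ++ b & last x s1 = y.
Proof.
case: a => [|x' a] [-> ->]; first by exists [::].
by exists (rcons a y); rewrite ?cat_rcons ?last_rcons.
Qed.

Lemma mem_closed_split x s y : last x s = x -> y \in s -> y != x ->
  exists p q, [/\ s = p ++ q, last x p = y, (0 < size p)%N & (0 < size q)%N].
Proof.
move=> lx ys; move: lx; case/splitPr: ys => p [|z q].
  by rewrite last_cat /= => ->; rewrite eqxx.
by exists (rcons p y), (z :: q); rewrite cat_rcons last_rcons size_rcons.
Qed.

End SeqSplit.

Section PathEdges.
Variable T : finType.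
Implicit Types (x y z : T) (p q c : seq T) (E : {set T}).

Lemma path_edges_cons x y p :
  path_edges x (y :: p) = [set x; y] |: path_edges y p.
Proof.
apply/setP=> E; rewrite !inE; apply/imsetP/orP.
  case=> a; rewrite /= inE => /orP[/eqP -> ->|ap ->]; first by left.
  by right; apply/imsetP; exists a.
case=> [/eqP ->|/imsetP[a ap ->]].
  by exists (x, y); rewrite //= inE eqxx.
by exists a; rewrite //= inE [_ \in _]ap orbT.
Qed.

Lemma path_edges_nil x : path_edges x [::] = set0.
Proof. by apply/setP=> E; rewrite inE; apply/imsetP=> -[]. Qed.

Lemma path_edges_cat x p q :
  path_edges x (p ++ q) = path_edges x p :|: path_edges (last x p) q.
Proof.
elim: p x => [|y p IH] x /=; first by rewrite path_edges_nil set0U.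
by rewrite !path_edges_cons IH setUA.
Qed.

Lemma path_edges_back x p : path_edges (last x p) (back x p) = path_edges x p.
Proof.
elim: p x => [//|y p IH] x.
rewrite -cat1s back_cat !path_edges_cat /= last_back IH setUC; congr (_ :|: _).
by rewrite !path_edges_cons !path_edges_nil [X in X |: _]setUC.
Qed.

Lemma path_edgesP x p E : reflect (exists a y b, p = a ++ y :: b /\ E = [set last x a; y])
  (E \in path_edges x p).
Proof.
apply: (iffP idP) => [|[a [y [b [-> ->]]]]]; last first.
  by rewrite path_edges_cat path_edges_cons !inE eqxx orbT.
elim: p x => [|y p IH] x; first by rewrite path_edges_nil inE.
rewrite path_edges_cons !inE => /orP[/eqP ->|/IH]; first by exists [::], y, p.
by case=> a [z [b [-> ->]]]; exists (y :: a), z, b.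
Qed.

Lemma path_edges_mem x p E y : E \in path_edges x p -> y \in E -> y \in x :: p.
Proof.
case/path_edgesP=> a [z [b [-> ->]]].
rewrite !inE mem_cat inE => /orP[] /eqP ->; last by rewrite eqxx !orbT.
by have := mem_last x a; rewrite inE => /orP[-> //|->]; rewrite orbT.
Qed.

Lemma path_edges_path (e : rel T) x p E : path e x p -> E \in path_edges x p ->
  exists y z, e y z /\ E = [set y; z].
Proof.
move=> ep /path_edgesP[a [z [b [def_p ->]]]]; exists (last x a), z.
by move: ep; rewrite def_p cat_path /= => /and3P[].
Qed.

Lemma path_next x c : uniq c -> last x c = x -> path (frel (next c)) x c.
Proof.
case: c => [//|y c] uc lx; have := cycle_next uc.
by rewrite /= rcons_path; move: lx => /= -> /andP[-> ->].
Qed.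

(** A cycle is also the closed walk at its last vertex, so that the cycles and the
    connecting path of a bow tie can be treated alike. *)
Lemma cycle_edges_closed x c : uniq c -> last x c = x ->
  cycle_edges c = path_edges x c.
Proof.
move=> uc lx; have pn := path_next uc lx.
have pE a z b : c = a ++ z :: b -> next c (last x a) = z.
  by move=> def_c; move: pn; rewrite {2}def_c cat_path /= => /and3P[_ /eqP].
apply/setP=> E; apply/imsetP/path_edgesP => [[w wc ->]|[a [z [b [def_c ->]]]]].
  have [a [b def_c]] : exists a b, c = rcons a w ++ b.
    by case/splitPr: wc => a b; exists a, b; rewrite cat_rcons.
  case: b def_c => [|z b] def_c; last first.
    exists (rcons a w), z, b; split=> //.
    by rewrite -(pE _ _ _ def_c) last_rcons.
  have wx : w = x by rewrite -lx def_c cats0 last_rcons.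
  have [z [b def_c']] : exists z b, c = z :: b.
    by rewrite def_c cats0; case: (a) => [|z b]; [exists w, [::] | exists z, (rcons b w)].
  by exists [::], z, b; split=> //; rewrite wx -(pE [::] z b def_c').
exists (last x a); last by rewrite (pE _ _ _ def_c).
have := mem_last x a; rewrite inE => /orP[/eqP ->|]; last first.
  by rewrite def_c mem_cat => ->.
have := mem_last x c; rewrite lx inE => /orP[_|//].
by rewrite -{1}lx def_c; rewrite last_cat /= mem_cat mem_last orbT.
Qed.

Lemma set2_eq x y x' y' : [set x; y] = [set x'; y'] ->
  x = x' /\ y = y' \/ x = y' /\ y = x'.
Proof.
move=> eqE; have := set21 x y; have := set22 x y; rewrite eqE.
case/set2P=> yE /set2P[] xE; subst; auto.
  by left; have := set22 x' y'; rewrite -eqE setUid => /set1P ->.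
by left; have := set21 x' y'; rewrite -eqE setUid => /set1P ->.
Qed.

Lemma cycle_edges_sub c E y :
  E \in cycle_edges c -> y \in E -> y \in c.
Proof. by case/imsetP=> w0 wc -> /set2P[] ->; rewrite ?mem_next. Qed.

Lemma bow_tie_edges_sub (B : bow_tie T) E y :
  E \in edges (bow_tie_graph B) -> y \in E -> y \in vertices (bow_tie_graph B).
Proof.
rewrite !inE !mem_cat => /orP[/orP[]|] BE yE.
- by rewrite (cycle_edges_sub BE yE).
- by rewrite (cycle_edges_sub BE yE) orbT.
by rewrite (path_edges_mem BE yE) !orbT.
Qed.

End PathEdges.

(** * A minimal dumbbell with non-zero defect is an induced bow tie *)

Section ExtremalDumbbell.
Variables (T : finType) (K : fieldType) (e : rel T) (h : T -> T -> K) (N : nat).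
Hypotheses (eC : forall x y, e x y = e y x) (hC : forall x y, h x y = h y x).
Hypothesis bal : balanced_below e h N.
Implicit Types (x y z : T) (p q A : seq T).

Definition extremal x o1 A o2 :=
  [/\ dumbbell e x o1 A o2, dumbbell_length o1 A o2 = N,
      longer_handles_vanish e h N (size A) & defect h x o1 A o2 != 0].

Lemma extremal_flip x o1 A o2 :
  extremal x o1 A o2 -> extremal (last x A) o2 (back x A) o1.
Proof.
case=> db len longer nz; split; first exact: dumbbell_flip.
- by rewrite -len /dumbbell_length size_back [(size o2 + _)%N]addnC.
- by rewrite size_back.
by rewrite defect_flip // mulf_neq0 // oppr_eq0 signr_eq0.
Qed.

Lemma link0 y : link e y [::] y.
Proof. by rewrite /link /= eqxx. Qed.

Lemma link1 y z : e y z -> link e y [:: z] z.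
Proof. by rewrite /link /= eqxx => ->. Qed.

Lemma odd_closed_last x p : odd_closed e x p -> last x p = x.
Proof. by case/and3P=> _ /eqP. Qed.

(** A repeated vertex is a link of length 0 inside the cycle. *)
Lemma extremal_uniq1 x o1 A o2 : extremal x o1 A o2 -> uniq o1.
Proof.
case=> db len longer; apply: contraTT => /not_uniq_split[y [a [b [c def1]]]].
move: db len; rewrite {}def1 -!cat_rcons => db len; rewrite negbK; apply/eqP.
apply: (cycle_chord eC hC bal longer db len (r := [::])).
all: by rewrite ?last_rcons ?size_rcons // link0.
Qed.

Lemma extremal_chord1 x o1 A o2 y z : extremal x o1 A o2 ->
  y \in o1 -> z \in o1 -> y != z -> e y z -> [set y; z] \in path_edges x o1.
Proof.
move=> ext yo zo; wlog: y z yo zo / exists a b c, o1 = a ++ y :: b ++ z :: c.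
  move=> IH yz eyz; have [a [b [c [|] def1]]] := two_mem_split yo zo yz.
    by apply: IH => //; exists a, b, c.
  by rewrite setUC; apply: IH; rewrite 1?eq_sym 1?eC //; exists a, b, c.
case=> a [b [c def1]] _ eyz; move: ext; rewrite def1 {yo zo def1}.
case: b => [|z' b] ext.
  by apply/path_edgesP; exists (rcons a y), z, c; rewrite cat_rcons last_rcons.
case: (ext) => db len longer nz.
have [/and3P[_ a0 /eqP/size0nil c0]|short] := boolP [&& size [:: z] == 1,
    size (rcons a y) == 1 & size c == 0]%N.
  have lx : last x (a ++ y :: (z' :: b) ++ z :: c) = x.
    by apply: odd_closed_last; case/and3P: db.
  move: a0 lx; rewrite size_rcons eqSS => /nilP ->.
  rewrite c0 !last_cat /= !last_cat /= => zx.
  apply/path_edgesP; exists [::], y, ((z' :: b) ++ [:: z]).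
  by rewrite /= zx setUC.
case/eqP: nz; move: db len; rewrite -cat_rcons -(cat_rcons z) => db len.
apply: (cycle_chord eC hC bal longer db len (r := [:: z])) => //.
- by rewrite !last_rcons link1.
- by rewrite size_rcons.
by rewrite size_rcons.
Qed.

Lemma extremal_handle_uniq x o1 A o2 : extremal x o1 A o2 -> uniq (x :: A).
Proof.
case=> db len longer nz; apply: contraT => /not_uniq_split[y [a [b [c def]]]].
have [A1 defA lA] := cons_split def; case/eqP: nz; move: db len.
rewrite defA -cat_rcons => db len.
apply: (handle_chord eC hC bal db len (r := [::])); rewrite ?size_rcons //.
by rewrite last_rcons lA link0.
Qed.

Lemma extremal_handle_chord x o1 A o2 y z : extremal x o1 A o2 ->
  y \in x :: A -> z \in x :: A -> y != z -> e y z -> [set y; z] \in path_edges x A.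
Proof.
move=> ext yA zA; wlog: y z yA zA / exists a b c, x :: A = a ++ y :: b ++ z :: c.
  move=> IH yz eyz; have [a [b [c [|] def]]] := two_mem_split yA zA yz.
    by apply: IH => //; exists a, b, c.
  by rewrite setUC; apply: IH; rewrite 1?eq_sym 1?eC //; exists a, b, c.
case=> a [b [c def]] _ eyz.
have [A1 defA lA] := cons_split def; case: ext => db len longer nz.
case: b {def} defA => [|z' b] defA.
  by apply/path_edgesP; exists A1, z, c; rewrite lA.
case/eqP: nz; move: db len; rewrite defA -cat_rcons => db len.
apply: (handle_chord eC hC bal db len (r := [:: z])); rewrite ?size_rcons //.
by rewrite last_rcons lA link1.
Qed.

Lemma extremal_cycle1_handle x o1 A o2 y v : extremal x o1 A o2 ->
  y \in o1 -> y != x -> v \in x :: A ->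
  y != v /\ (e y v -> [set y; v] \in path_edges x o1).
Proof.
case=> db len longer nz yo yx.
have lx : last x o1 = x by apply: odd_closed_last; case/and3P: db.
have [p [q [def1 lp p0 q0]]] := mem_closed_split lx yo yx.
move=> vA; move: db len nz; rewrite def1; case/splitPl: vA => A1 A2 lA db len nz.
have far r : link e (last x p) r (last x A1) ->
    (size q + size A1 <= size r)%N \/ (size p + size A1 <= size r)%N.
  move=> lk; have [|rq] := leqP (size q + size A1) (size r); first by left.
  have [|rp] := leqP (size p + size A1) (size r); first by right.
  by case/eqP: nz; apply: (cycle_handle_link_lt eC hC bal db len lk).
split.
  apply/eqP=> yv; have := far [::]; rewrite lp lA yv link0 => /(_ isT).
  by rewrite !leqn0 !addn_eq0 (gtn_eqF p0) (gtn_eqF q0); case.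
move=> eyv; have := far [:: v]; rewrite lp lA link1 // => /(_ isT) /=.
have oneP s : (0 < size s)%N -> (size s + size A1 <= 1)%N ->
    v = x /\ exists z, s = [:: z].
  move=> s0 s1; have/size0nil A10 : (size A1 = 0)%N by lia.
  rewrite -lA A10; split=> //.
  by case: s s0 s1 => [//|z [|z' s]] // _ _; exists z.
case=> /oneP[] // -> [z def].
  move: lx; rewrite def1 def last_cat /= => zx.
  by apply/path_edgesP; exists p, z, [::]; rewrite lp zx.
move: lp; rewrite def /= => <-.
by apply/path_edgesP; exists [::], z, q; rewrite setUC.
Qed.

Lemma extremal_cycles x o1 A o2 y z : extremal x o1 A o2 ->
  y \in o1 -> y != x -> z \in o2 -> z != last x A -> (y != z) && ~~ e y z.
Proof.
case=> db len longer nz yo yx zo zx.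
have [lx lz] : last x o1 = x /\ last (last x A) o2 = last x A.
  by case/and3P: db => *; split; apply: odd_closed_last.
have [p [q [def1 lp p0 q0]]] := mem_closed_split lx yo yx.
have [p2 [q2 [def2 lp2 p20 q20]]] := mem_closed_split lz zo zx.
move: db len nz; rewrite def1 def2 => db len nz.
have far r : ~~ link e y r z.
  apply: contra nz; rewrite -lp -lp2 => lk; apply/eqP.
  by apply: (cycle_cycle_no_link eC hC bal db len lk); rewrite p0 q0 p20.
apply/andP; split; first by apply: contra (far [::]) => /eqP->; apply: link0.
by apply: contra (far [:: z]) => /link1.
Qed.

Lemma path_mem_edge x p y : path e x p -> y \in p -> exists z, e z y.
Proof.
elim: p x => [//|z p IH] x /= /andP[exz ep]; rewrite inE => /orP[/eqP ->|/(IH z ep)//].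
by exists x.
Qed.

Lemma extremal_cycle2_handle x o1 A o2 y v : extremal x o1 A o2 ->
  y \in o2 -> y != last x A -> v \in x :: A ->
  y != v /\ (e y v -> [set y; v] \in path_edges (last x A) o2).
Proof.
move=> /extremal_flip ext yo yx vA; apply: extremal_cycle1_handle ext yo yx _.
move: vA; rewrite lastI mem_rcons inE => /orP[/eqP ->|]; first exact: mem_head.
by rewrite inE mem_rev => ->; rewrite orbT.
Qed.

Lemma odd_closed_mem x p : odd_closed e x p -> x \in p.
Proof.
case/and3P=> _ /eqP lx; case: p lx => [//|y p] /= lx _.
by rewrite -lx mem_last.
Qed.

Lemma extremal_shape x o1 A o2 : extremal x o1 A o2 ->
    [/\ [disjoint o1 & o2], uniq (x :: A) /\ (0 < size A)%N,
      x \in o1 /\ last x A \in o2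
      & forall z, z \in x :: A -> z \in o1 ++ o2 -> z = x \/ z = last x A]
    \/ A = [::] /\ (forall z, (z \in o1) && (z \in o2) = (z == x)).
Proof.
move=> ext; case: (ext) => db _ _ _; case/and3P: db => c1 _ c2.
have [m1 m2] := (odd_closed_mem c1, odd_closed_mem c2).
have uA := extremal_handle_uniq ext.
have lA : last x A \in x :: A by exact: mem_last.
have [A0|A0] := posnP (size A); [right | left; split=> //].
- move/size0nil: A0 => A0; subst A; split=> // z; apply/andP/eqP=> [[z1 z2]|->//].
  apply/eqP; apply: contraT => zx; have /= := extremal_cycles ext z1 zx z2 zx.
  by rewrite eqxx.
- apply/pred0P=> z /=; apply/negbTE/negP=> /andP[z1 z2].
  have [zx|zx] := eqVneq z x; last first.
    have [zl|zl] := eqVneq z (last x A).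
      by have [] := extremal_cycle1_handle ext z1 zx lA; rewrite zl eqxx.
    by have := extremal_cycles ext z1 zx z2 zl; rewrite eqxx.
  have [zl|zl] := eqVneq z (last x A); last first.
    by have [] := extremal_cycle2_handle ext z2 zl (mem_head x A); rewrite zx eqxx.
  case: (A) A0 uA zl => [//|w B] _ /andP[/negP xB _]; rewrite zx /= => xl.
  by apply: xB; rewrite xl mem_last.
move=> z zA; rewrite mem_cat => /orP[zo|zo]; [left | right]; apply/eqP.
  by apply: contraT => zx; have [] := extremal_cycle1_handle ext zo zx zA; rewrite eqxx.
by apply: contraT => zx; have [] := extremal_cycle2_handle ext zo zx zA; rewrite eqxx.
Qed.

(** A common edge of both cycles is a loop at a common vertex x, the cycles being
    otherwise disjoint. Then both cycles are this loop and the defect is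
    h x x - h x x. *)
Lemma extremal_edges_disjoint x o1 A o2 : extremal x o1 A o2 ->
  [disjoint cycle_edges o1 & cycle_edges o2].
Proof.
move=> ext; case: (ext) => db _ _ nz; case/and3P: (db) => c1 _ c2.
have [u1 u2] := (extremal_uniq1 ext, extremal_uniq1 (extremal_flip ext)).
apply/pred0P=> E /=; apply/negbTE/negP=> /andP[/imsetP[y yo ->] /imsetP[z zo]].
have mem2 t : t \in [set y; next o1 y] -> t \in [set z; next o2 z] ->
    (t \in o1) && (t \in o2).
  move=> t1 t2; apply/andP; split.
    by case/set2P: t1 => ->; rewrite ?mem_next.
  by case/set2P: t2 => ->; rewrite ?mem_next.
move=> eqE.
have yy : (y \in o1) && (y \in o2) by apply: mem2; rewrite -?eqE set21.
have ny : (next o1 y \in o1) && (next o1 y \in o2).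
  by apply: mem2; rewrite -?eqE set22.
have zz : (z \in o1) && (z \in o2) by apply: mem2; rewrite ?eqE set21.
have nz' : (next o2 z \in o1) && (next o2 z \in o2).
  by apply: mem2; rewrite ?eqE set22.
case: (extremal_shape ext) => [[dis _ _ _]|[A0 eqx]].
  by move: dis => /pred0P/(_ y); rewrite /= yy.
have x1 : next o1 x = x.
  by move: ny yy; rewrite !eqx => /eqP + /eqP def_y; rewrite def_y.
have x2 : next o2 x = x.
  by move: nz' zz; rewrite !eqx => /eqP + /eqP def_z; rewrite def_z.
have loopE o : uniq o -> odd_closed e x o -> next o x = x -> o = [:: x].
  case: o => [_ /and3P[]//|w o] uo /odd_closed_last lx.
  have := path_next uo lx; rewrite /= => /andP[/eqP -> _] wx.
  move: uo lx; rewrite wx; case: o => [//|v o] /= /andP[/negP xo _] lx.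
  by case: xo; rewrite -{1}lx mem_last.
case/eqP: nz; rewrite (loopE _ u1 c1 x1) A0 (loopE o2) // ?A0 //; last first.
  by move: c2; rewrite A0.
by rewrite /defect /= mulr0 !subr0 expr0 mul1r subrr.
Qed.

Lemma extremal_bow_tie x o1 A o2 : extremal x o1 A o2 ->
  exists B : bow_tie T,
    [/\ [/\ bt_cycle1 B = o1, bt_cycle2 B = o2, bt_start B = x & bt_path B = A],
        forall E, E \in edges (bow_tie_graph B) -> exists y z, e y z /\ E = [set y; z],
        forall y z, y \in vertices (bow_tie_graph B) ->
          z \in vertices (bow_tie_graph B) -> y != z -> e y z ->
          [set y; z] \in edges (bow_tie_graph B)
      & forall y, y \in vertices (bow_tie_graph B) -> exists z, e z y].
Proof.
move=> ext; case: (ext) => db _ _ nz; case/and3P: (db) => c1 pA c2.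
have ext' := extremal_flip ext.
have [u1 u2] := (extremal_uniq1 ext, extremal_uniq1 ext').
have odd1 : odd_cycle o1 by rewrite /odd_cycle u1; case/and3P: c1.
have odd2 : odd_cycle o2 by rewrite /odd_cycle u2; case/and3P: c2.
exists (BowTie odd1 odd2 (extremal_edges_disjoint ext) (extremal_shape ext)).
have vertex_edge y : y \in o1 ++ o2 ++ x :: A -> exists z, e z y.
  case/and3P: c1 (odd_closed_mem c1) c2 => p1 _ _ x1 /and3P[p2 _ _].
  rewrite !mem_cat inE => /or4P[yo|yo|/eqP ->|yA].
  - exact: path_mem_edge p1 yo.
  - exact: path_mem_edge p2 yo.
  - exact: path_mem_edge p1 x1.
  exact: path_mem_edge pA yA.
rewrite /bow_tie_graph /=; split=> //; last by move=> y; rewrite inE; apply: vertex_edge.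
  move=> E; rewrite (cycle_edges_closed u1 (odd_closed_last c1)).
  rewrite (cycle_edges_closed u2 (odd_closed_last c2)) !inE.
  case/and3P: c1 c2 => p1 _ _ /and3P[p2 _ _].
  by move=> /orP[/orP[]|] /path_edges_path; apply.
rewrite (cycle_edges_closed u1 (odd_closed_last c1)).
rewrite (cycle_edges_closed u2 (odd_closed_last c2)).
have split3 t : t \in o1 ++ o2 ++ x :: A ->
    [|| (t \in o1) && (t != x), (t \in o2) && (t != last x A) | t \in x :: A].
  rewrite !mem_cat => /or3P[] t_in; last by rewrite t_in !orbT.
    by have [->|tx] := eqVneq t x; rewrite ?mem_head ?t_in ?orbT.
  by have [->|tx] := eqVneq t (last x A); rewrite ?mem_last ?t_in ?orbT.
move=> y z; rewrite !inE => /split3 yB /split3 zB yz eyz.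
have zy : z != y by rewrite eq_sym.
have ezy : e z y by rewrite eC.
case/or3P: yB => [/andP[y1 yx]|/andP[y2 yx]|yA];
  case/or3P: zB => [/andP[z1 zx]|/andP[z2 zx]|zA].
- by rewrite (extremal_chord1 ext).
- by have := extremal_cycles ext y1 yx z2 zx; rewrite eyz andbF.
- by have [_ ->] := extremal_cycle1_handle ext y1 yx zA.
- by have := extremal_cycles ext z1 zx y2 yx; rewrite ezy andbF.
- by rewrite (extremal_chord1 ext') ?orbT.
- by have [_ ->] := extremal_cycle2_handle ext y2 yx zA; rewrite ?orbT.
- by have [_ /(_ ezy)] := extremal_cycle1_handle ext z1 zx yA; rewrite setUC => ->.
- have [_ /(_ ezy)] := extremal_cycle2_handle ext z2 zx yA.
  by rewrite setUC => ->; rewrite ?orbT.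
- by rewrite (extremal_handle_chord ext) ?orbT.
Qed.

End ExtremalDumbbell.

(** * Weights with vanishing alternating sums are potentials *)

Section BalancedWalks.
Variables (T : finType) (K : fieldType) (e : rel T) (h : T -> T -> K) (u : T -> nat).
Hypotheses (eC : forall x y, e x y = e y x) (hC : forall x y, h x y = h y x).
Hypotheses (u_edge : forall x y, e x y -> (0 < u y)%N)
           (u_loop : forall x, e x x -> (1 < u x)%N).
Hypothesis thin_walks : forall x p, path e x p -> last x p = x ->
  ~~ odd (size p) -> (forall v, count_mem v p <= u v)%N -> altsum h x p = 0.
Hypothesis good_bow_ties : forall B : bow_tie T,
  (forall E, E \in edges (bow_tie_graph B) -> exists y z, e y z /\ E = [set y; z]) ->
  (forall y z, y \in vertices (bow_tie_graph B) -> z \in vertices (bow_tie_graph B) ->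
     y != z -> e y z -> [set y; z] \in edges (bow_tie_graph B)) ->
  (forall y, y \in vertices (bow_tie_graph B) -> exists z, e z y) ->
  monedge B /\ both_loops B \/ path_degenerate B /\ looped B.

Lemma uniq_thin x p v : path e x p -> uniq p -> (count_mem v p <= u v)%N.
Proof.
move=> ep up; rewrite count_uniq_mem //; case vp: (v \in p) => //.
by have [z /u_edge] := path_mem_edge ep vp.
Qed.

(** The closed walk around a path-degenerate looped bow tie visits only the base
    of the loop twice. *)
Lemma loop_cycle_thin x p v : odd_closed e x [:: x] -> path e x p -> uniq p ->
  (count_mem v (x :: p) <= u v)%N.
Proof.
case/and3P=> /andP[exx _] _ _ ep up /=.
have [<-|_] := eqVneq x v; last exact: uniq_thin ep up.
by rewrite count_uniq_mem // (leq_trans _ (u_loop exx)) // add1n ltnS leq_b1.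
Qed.

(** The bow tie is of one of the two allowed types, and then its closed walk visits
    twice only bases of its loops. *)
Lemma no_extremal N x o1 A o2 : balanced_below e h N -> ~ extremal e h N x o1 A o2.
Proof.
move=> bal ext.
have [B [[B1 B2 Bs Bp] B_edges B_chords B_verts]] := extremal_bow_tie eC hC bal ext.
have [u1 u2] := (extremal_uniq1 eC hC bal ext,
                 extremal_uniq1 eC hC bal (extremal_flip eC hC ext)).
have uA := extremal_handle_uniq eC hC bal ext.
case: ext => db _ _ /eqP; apply; case/and3P: (db) => c1 pA c2.
rewrite -(defect_walk hC db); have [p1 p2 p3 p4] := dumbbell_walk eC db.
apply: thin_walks => // v; case: (good_bow_ties B_edges B_chords B_verts).
  rewrite /monedge /both_loops /is_loop B1 B2 Bp.
  have single s : size s = 1%N -> exists y, s = [:: y].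
    by case: s => [|y [|]] // _; exists y.
  case=> /single[z defA] [/eqP/single[y def1] /eqP/single[w def2]].
  move: c1 c2 uA; rewrite {}def1 {}def2 {}defA /=.
  move=> /[dup] /odd_closed_last /= -> /and3P[/andP[/u_loop xx _] _ _].
  move=> /[dup] /odd_closed_last /= -> /and3P[/andP[/u_loop zz _] _ _].
  rewrite inE andbT.
  have [<-|xv] := eqVneq x v; first by rewrite eq_sym => /negbTE ->.
  by have [<-|] := eqVneq z v.
rewrite /path_degenerate /looped /is_loop B1 B2 Bp.
case=> A0; move: c2 {pA uA p4}; rewrite A0 /= => c2.
have loopE o : odd_closed e x o -> size o == 1%N -> o = [:: x].
  by case: o => [|y [|]] // /odd_closed_last /= ->.
case=> [/(loopE _ c1) def1|/(loopE _ c2) def2].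
  rewrite def1 /back /= cats0; rewrite def1 in c1.
  by apply: loop_cycle_thin => //; case/and3P: c2.
rewrite def2 /back /= count_cat addnC -count_cat; rewrite def2 in c2.
by apply: loop_cycle_thin => //; case/and3P: c1.
Qed.

(** Induction on the length of the handle, from long handles to short ones. *)
Lemma dumbbells_vanish N x o1 A o2 : balanced_below e h N -> dumbbell e x o1 A o2 ->
  dumbbell_length o1 A o2 = N -> defect h x o1 A o2 = 0.
Proof.
move=> bal; have [n] := ubnP (N - size A).
elim: n x o1 A o2 => // n IH x o1 A o2 An db len.
apply/eqP; apply: contraT => nz; case: (@no_extremal N x o1 A o2 bal); split=> //.
move=> x' o1' A' o2' db' len' lt; apply: IH => //.
have A'N : (size A' <= N)%N by rewrite -len' /dumbbell_length -addnn; lia.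
rewrite ltnS in An; apply: leq_trans An.
by rewrite ltn_sub2l // (leq_trans lt).
Qed.

(** A repeated vertex splits a closed even walk into two closed walks. If both are
    even, they are shorter; if both are odd, they form a dumbbell with empty
    handle. *)
Lemma balanced N : balanced_below e h N.
Proof.
elim: N => [x p _ _ _|N bal x p ep lx op]; first by rewrite ltn0.
rewrite ltnS leq_eqVlt => /orP[/eqP pN|]; last exact: bal.
have [up|/not_uniq_split[y [a [b [c def]]]]] := boolP (uniq p).
  by apply: thin_walks => // v; apply: uniq_thin ep up.
move: ep lx op pN; rewrite {}def -!cat_rcons; set a' := rcons a y; set b' := rcons b y.
rewrite !cat_path !last_cat !last_rcons => /and3P[pa pb pc] lx op pN.
have sa : (0 < size a')%N by rewrite size_rcons.
have sb : (0 < size b')%N by rewrite size_rcons.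
rewrite !size_cat !oddD in op; rewrite !size_cat in pN.
have ly : last x a' = y by rewrite last_rcons.
have lb : last y b' = y by rewrite last_rcons.
have [ob|ob] := boolP (odd (size b')); last first.
  have b0 : altsum h y b' = 0 by apply: bal => //; rewrite ?last_rcons //; lia.
  have ac0 : altsum h x (a' ++ c) = 0.
    apply: bal; rewrite ?cat_path ?last_cat ?ly ?pa ?lx // ?size_cat ?oddD.
      by move: op ob; case_odd.
    by lia.
  move: ac0; rewrite !altsum_cat ly lb b0 add0r !sgP (negbTE ob) => <-.
  by rewrite mul1r.
have db : dumbbell e y b' [::] (c ++ a').
  rewrite /dumbbell /odd_closed /= cat_path last_cat lx ly pa pb pc !last_rcons !eqxx ob /=.
  by rewrite size_cat oddD; move: op ob; case_odd.
have len : dumbbell_length b' [::] (c ++ a') = N.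
  by rewrite -pN /dumbbell_length size_cat addn0 (addnC (size c)) addnCA.
have := dumbbells_vanish bal db len; rewrite /defect /= altsum_cat lx.
rewrite mulr0 subr0 expr0 mul1r => eq0; rewrite !altsum_cat ly lb.
transitivity ((-1) ^+ size a' *
    (altsum h y b' - (altsum h y c + (-1) ^+ size c * altsum h x a'))).
  by rewrite !sgP ob; move: op ob; do 3![case: (odd _) => //=] => _ _; ring.
by rewrite eq0 mulr0.
Qed.

End BalancedWalks.

Section Potential.
Variables (T : finType) (K : fieldType) (e : rel T) (h : T -> T -> K).
Hypotheses (eC : forall x y, e x y = e y x) (hC : forall x y, h x y = h y x).
Hypothesis two_neq0 : (2%:R : K) != 0.
Hypothesis bal : forall N, balanced_below e h N.

(** Even closed walks lift to closed walks of the double cover, and closed walks of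
    the double cover are even. *)
Definition double_cover : rel (T * bool) := [rel a b | e a.1 b.1 && (a.2 != b.2)].

Lemma double_cover_sym : forall a b, double_cover a b = double_cover b a.
Proof. by move=> a b; rewrite /double_cover /= eC eq_sym. Qed.

Lemma double_cover_path a p : path double_cover a p ->
  path e a.1 (map fst p) /\ (last a p).2 = a.2 (+) odd (size p).
Proof.
elim: p a => [|b p IH] a /=; first by rewrite addbF.
case/andP=> /andP[-> ab] /IH[-> ->]; split=> //.
by move: ab; case: a.2; case: b.2; case: odd.
Qed.

(** On the double cover a potential is found by summing up along walks from a root of
    each component; the mean of its values on the two sheets is a potential for
    h. *)
Lemma potential : exists g : T -> K, forall x y, e x y -> h x y = g x + g y.
Proof.
have coverC : connect_sym double_cover.
  exact: sym_connect_sym double_cover_sym.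
pose pot (r : T * bool) (p : seq (T * bool)) : K :=
  - (-1) ^+ size p * altsum h r.1 (map fst p).
have /fin_all_exists[Q QE] : forall a : T * bool, exists t : K, forall p,
    path double_cover (fingraph.root double_cover a) p ->
    last (fingraph.root double_cover a) p = a ->
    pot (fingraph.root double_cover a) p = t.
  move=> a; set r := fingraph.root double_cover a; have : connect double_cover r a.
    by rewrite coverC connect_root.
  case/connectP=> p0 ep0 def_a; exists (pot r p0) => p ep lp; rewrite /pot.
  have [fp sp] := double_cover_path ep; have [fp0 sp0] := double_cover_path ep0.
  have o : odd (size p) = odd (size p0).
    by apply: (can_inj (addKb r.2)); rewrite -sp -sp0 lp -def_a.
  rewrite (eq_altsum eC hC (@bal (size p + size p0).+1) fp fp0) ?size_map //.
    by rewrite !sgP o.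
  by rewrite !last_map lp -def_a.
exists (fun x => (Q (x, true) + Q (x, false)) / 2%:R) => x y exy.
have edgeE b : h x y = Q (x, b) + Q (y, ~~ b).
  have xy : double_cover (x, b) (y, ~~ b) by rewrite /double_cover /= exy; case: b.
  have rE : fingraph.root double_cover (y, ~~ b) = fingraph.root double_cover (x, b).
    by apply/eqP; rewrite root_connect // coverC; apply: connect1.
  have : connect double_cover (fingraph.root double_cover (x, b)) (x, b).
    by rewrite coverC connect_root.
  case/connectP=> p ep lp.
  rewrite -(QE (x, b) p) // -(QE (y, ~~ b) (rcons p (y, ~~ b))); last first.
  - by rewrite last_rcons.
  - by rewrite rE rcons_path ep -lp.
  rewrite rE /pot size_rcons map_rcons -cats1 altsum_cat size_map last_map -lp /=.
  by rewrite exprS subr0 !sgP; case: odd; ring.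
apply: (mulIf two_neq0); rewrite -mulrDl divfK // mulr_natr mulr2n.
by rewrite {1}(edgeE true) (edgeE false) /=; ring.
Qed.

End Potential.

(** * Polarizability of monomials in terms of weights *)

Section SubmodGen.
Variables (A : pzRingType) (M : lmodType A) (G : M -> Prop).

Lemma submod_gen_scale (c : A) v : G v -> submod_gen G (c *: v).
Proof.
by move=> Gv; exists [:: (c, v)] => [w|]; rewrite ?big_seq1 // inE => /eqP ->.
Qed.

Lemma submod_gen_sum (I : Type) (r : seq I) (P : pred I) (F : I -> M) :
  (forall i, P i -> submod_gen G (F i)) -> submod_gen G (\sum_(i <- r | P i) F i).
Proof.
move=> GF; apply: (big_ind (submod_gen G)) => //.
  by exists [::]; rewrite ?big_nil.
move=> _ _ [s Gs ->] [t Gt ->]; exists (s ++ t); last by rewrite big_cat.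
by move=> c; rewrite mem_cat => /orP[/Gs|/Gt].
Qed.

End SubmodGen.

Section MonomialAlgebra.
Variables (k : fieldType) (n m : nat) (a : 'I_m -> 'X_{1..n}).
Variable f : m.-tuple {mpoly k[n]}.
Hypothesis fE : forall j, tnth f j = 'X_[a j].
Implicit Types (u : 'X_{1..n}) (al be : 'X_{1..m}) (w : 'I_m -> k).
Implicit Types (F : {mpoly k[m]}) (v : 'rV[{mpoly k[n]}]_m).

(** The exponent of the monomial f^al. *)
Definition image_mnm al : 'X_{1..n} := (\sum_j a j *+ al j)%MM.

Lemma image_mnmE al i : image_mnm al i = (\sum_j a j i * al j)%N.
Proof. by rewrite mnm_sumE; apply: eq_bigr => j _; rewrite mulmnE. Qed.

Lemma comp_mnm al : 'X_[al] \mPo f = 'X_[image_mnm al].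
Proof.
rewrite comp_mpolyX (big_morph _ (mpolyXD _) (mpolyX0 _ _)).
by apply: eq_bigr => j _; rewrite fE mpolyXn.
Qed.

Lemma lemX_coef (p : {mpoly k[n]}) u u' : (p * 'X_[u])@_u' != 0 -> (u <= u')%MM.
Proof.
apply: contraR => nle; rewrite mcoeffM big1 // => -[b c] /= /eqP def_u'.
rewrite mcoeffX; have [uc|] := eqVneq u c; last by rewrite mulr0.
by case/negP: nle; rewrite def_u' uc lem_addl.
Qed.

Lemma mulX_deriv (R : comNzRingType) N (al : 'X_{1..N}) (j : 'I_N) :
  'X_[al]^`M(j) * 'X_j = (al j)%:R *: 'X_[al] :> {mpoly R[N]}.
Proof.
rewrite mderivX -scalerAl -mpolyXD; case: (posnP (al j)) => [->|al0].
  by rewrite !scale0r.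
by rewrite submK // lep1mP -lt0n.
Qed.

(** Multiplying the j-th entry by f_j makes all entries of a homogeneous row
    multiples of the same monomial. *)
Definition sym_coef v j u : k := (v 0 j * 'X_[a j])@_u.

(** T_j d/dT_j multiplies T^al by al_j. *)
Lemma gradient_symbol F j :
  gradient_at f F 0 j * 'X_[a j] =
  \sum_(al <- msupp F) (F@_al * (al j)%:R) *: 'X_[image_mnm al].
Proof.
have -> : 'X_[a j] = 'X_j \mPo f :> {mpoly k[n]}.
  by rewrite comp_mpolyXU -tnth_nth fE.
rewrite mxE -rmorphM /= {1}[F]mpolyE raddf_sum mulr_suml raddf_sum /=.
apply: eq_bigr => al _.
by rewrite mderivZ -scalerAl mulX_deriv scalerA comp_mpolyZ comp_mnm.
Qed.

Lemma gradient_coef F j u : sym_coef (gradient_at f F) j u =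
  \sum_(al <- msupp F | image_mnm al == u) F@_al * (al j)%:R.
Proof.
rewrite /sym_coef gradient_symbol raddf_sum [RHS]big_mkcond /=.
apply: eq_bigr => al _; rewrite mcoeffZ mcoeffX.
by case: eqP => _; rewrite ?mulr1 ?mulr0.
Qed.

Lemma comp_coef F u :
  (F \mPo f)@_u = \sum_(al <- msupp F | image_mnm al == u) F@_al.
Proof.
rewrite comp_mpolyEX raddf_sum [RHS]big_mkcond /=.
apply: eq_bigr => al _; rewrite comp_mnm mcoeffZ mcoeffX.
by case: eqP => _; rewrite ?mulr1 ?mulr0.
Qed.

Definition weight w al : k := \sum_j w j * (al j)%:R.

(** Below x^u, the weight of al depends on f^al only. *)
Definition weight_determined w u := forall al be,
  image_mnm al = image_mnm be -> (image_mnm al <= u)%MM -> weight w al = weight w be.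

(** In degree u the weight is constant on the monomials of F, and the sum of their
    coefficients is a coefficient of F(f) = 0. *)
Lemma gradient_vanish w u F : weight_determined w u -> presentation_ideal f F ->
  \sum_j w j * sym_coef (gradient_at f F) j u = 0.
Proof.
move=> wu F0; under eq_bigr do rewrite gradient_coef mulr_sumr.
rewrite exchange_big /=; under eq_bigr do under eq_bigr do rewrite mulrCA.
under eq_bigr do rewrite -mulr_sumr -/(weight w _).
have [/hasP[al0 _ /eqP al0u]|no_al] := boolP (has [pred al | image_mnm al == u] (msupp F)).
  under eq_bigr => al /eqP alu.
    rewrite (wu al al0); [over | by rewrite alu al0u | by rewrite alu lepm_refl].
  by rewrite -mulr_suml -comp_coef F0 mcoeff0 mul0r.
rewrite big_seq_cond big1 // => al /andP[alF alu]; case/hasP: no_al.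
by exists al.
Qed.

Lemma polar_vanish w u v : weight_determined w u -> polar_syzygy f v ->
  \sum_j w j * sym_coef v j u = 0.
Proof.
move=> wu [s Gs ->]; rewrite /sym_coef.
under eq_bigr do rewrite summxE mulr_suml raddf_sum mulr_sumr.
rewrite exchange_big big_seq big1 //= => -[g v'] /Gs /= [F F0 ->].
under eq_bigr do rewrite mxE -mulrA mcoeffM mulr_sumr.
rewrite exchange_big big1 //= => -[b c] /= /eqP def_u.
under eq_bigr do rewrite mulrCA; rewrite -mulr_sumr gradient_vanish ?mulr0 //.
move=> al be eq_ab le; apply: wu => //; apply: lepm_trans le _.
have : (c <= b + c)%MM by apply: lem_addl.
by rewrite -def_u.
Qed.

Lemma sym_coef_inj v v' : (forall j u, sym_coef v j u = sym_coef v' j u) -> v = v'.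
Proof.
move=> eq_vv; apply/rowP=> j; have/mulIf: 'X_[a j] != 0 :> {mpoly k[n]}.
  by apply/eqP=> /(congr1 (mcoeff (a j)))/eqP; rewrite mcoeffX eqxx mcoeff0 oner_eq0.
by apply; apply/mpolyP=> u; apply: eq_vv.
Qed.

(** x_i d/dx_i multiplies f_j by the exponent of x_i in f_j. *)
Lemma diff_syzygyP v : diff_syzygy f v <->
  forall i u, \sum_j (a j i)%:R * sym_coef v j u = 0.
Proof.
have symE i : (\sum_j v 0 j * (tnth f j)^`M(i)) * 'X_i =
    \sum_j (a j i)%:R *: (v 0 j * 'X_[a j]).
  rewrite mulr_suml; apply: eq_bigr => j _.
  by rewrite fE -mulrA mulX_deriv scalerAr.
have coefE i u : ((\sum_j v 0 j * (tnth f j)^`M(i)) * 'X_i)@_u =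
    \sum_j (a j i)%:R * sym_coef v j u.
  by rewrite symE raddf_sum; apply: eq_bigr => j _; rewrite /= mcoeffZ.
split=> [vZ i u|vZ i]; first by rewrite -coefE vZ mul0r mcoeff0.
have/mulIf: 'X_i != 0 :> {mpoly k[n]}.
  by apply/eqP=> /(congr1 (mcoeff U_(i)))/eqP; rewrite mcoeffX eqxx mcoeff0 oner_eq0.
by apply; rewrite mul0r; apply/mpolyP=> u; rewrite coefE vZ mcoeff0.
Qed.

(** The exponent of x_i in f^al is a weight that is determined by f^al. *)
Lemma polar_diff v : polar_syzygy f v -> diff_syzygy f v.
Proof.
move=> vP; apply/diff_syzygyP=> i u; apply: (polar_vanish _ vP) => al be eq_ab _.
have weightE al' : weight (fun j => (a j i)%:R) al' = (image_mnm al' i)%:R.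
  by rewrite image_mnmE natr_sum; apply: eq_bigr => j _; rewrite natrM.
by rewrite !weightE eq_ab.
Qed.

Definition homogeneous_row (c : 'I_m -> k) u : 'rV[{mpoly k[n]}]_m :=
  \row_j (c j *: 'X_[u - a j]).

Lemma sym_coef_homogeneous c u u' j : (c j != 0 -> (a j <= u)%MM) ->
  sym_coef (homogeneous_row c u) j u' = if u == u' then c j else 0.
Proof.
rewrite /sym_coef mxE -scalerAl mcoeffZ -mpolyXD.
have [->|_ /(_ isT) le] := eqVneq (c j) 0; first by rewrite mul0r if_same.
by rewrite submK // mcoeffX; case: eqP; rewrite ?mulr1 ?mulr0.
Qed.

Hypothesis a_pos : forall j, (0 < mdeg (a j))%N.

Lemma mdeg_image al : (mdeg al <= mdeg (image_mnm al))%N.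
Proof.
rewrite mdeg_sum mdegE leq_sum // => j _.
by rewrite mdegMn leq_pmull.
Qed.

Lemma lem_mdeg u u' : (u <= u')%MM -> (mdeg u <= mdeg u')%N.
Proof. by move/mnm_lepP=> le; rewrite !mdegE leq_sum. Qed.

Lemma gradient_binomial al be j : image_mnm al = image_mnm be ->
  gradient_at f ('X_[al] - 'X_[be]) 0 j * 'X_[a j] =
  ((al j)%:R - (be j)%:R) *: 'X_[image_mnm al].
Proof.
have gX al' : gradient_at f 'X_[al'] 0 j * 'X_[a j] = (al' j)%:R *: 'X_[image_mnm al'].
  by rewrite gradient_symbol msuppX big_seq1 mcoeffX eqxx mul1r.
move=> eq_ab; rewrite mxE mderivB comp_mpolyB mulrBl.
have := gX al; have := gX be; rewrite !mxE => -> ->.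
by rewrite -eq_ab scalerBl.
Qed.

(** The rows al - be with f^al = f^be dividing x^u span the polar relations in degree
    u. They are finitely many, since f has no constant members. By duality c lies
    in their span, because the columns of [cokermx W] are weights that are
    determined below u. *)
Lemma homogeneous_polar c u : (forall j, c j != 0 -> (a j <= u)%MM) ->
  (forall w, weight_determined w u -> \sum_j w j * c j = 0) ->
  polar_syzygy f (homogeneous_row c u).
Proof.
move=> cu cw; pose D := (mdeg u).+1.
pose I : finType := ('X_{1..m < D} * 'X_{1..m < D})%type.
pose valid := [pred i : I | (image_mnm i.1 == image_mnm i.2) && (image_mnm i.1 <= u)%MM].
pose W : 'M[k]_(#|I|, m) := \matrix_(i, j)
  if valid (enum_val i) then ((enum_val i).1 j)%:R - ((enum_val i).2 j)%:R else 0.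
have : (\row_j c j <= W)%MS.
  rewrite submxE; apply/eqP/rowP=> l; rewrite !mxE.
  under eq_bigr do rewrite mxE mulrC.
  apply: cw => al be eq_ab le.
  have alD : (mdeg al < D)%N.
    by rewrite ltnS (leq_trans (mdeg_image al)) // lem_mdeg.
  have beD : (mdeg be < D)%N.
    by rewrite ltnS (leq_trans (mdeg_image be)) // lem_mdeg // -eq_ab.
  (* The row of W for the pair (al, be) is annihilated by [cokermx W]. *)
  pose i : I := (BMultinom alD, BMultinom beD).
  have := congr1 (fun B : 'M__ => B (enum_rank i) l) (mulmx_coker W).
  rewrite !mxE; under eq_bigr do rewrite mxE enum_rankK /= eq_ab eqxx -eq_ab le mulrBl.
  rewrite sumrB => /eqP; rewrite subr_eq0 => /eqP eqw.
  rewrite /weight; under eq_bigr do rewrite mulrC.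
  by rewrite eqw; apply: eq_bigr => j _; rewrite mulrC.
case/submxP=> d def_c.
have -> : homogeneous_row c u = \sum_(i | valid (enum_val i))
    (d 0 i *: 'X_[u - image_mnm (enum_val i).1]) *:
      gradient_at f ('X_[(enum_val i).1] - 'X_[(enum_val i).2]).
  apply: sym_coef_inj => j u'; rewrite sym_coef_homogeneous; last exact: cu.
  rewrite /sym_coef summxE mulr_suml raddf_sum /=.
  have c_rows : c j = \sum_(i | valid (enum_val i))
      d 0 i * (((enum_val i).1 j)%:R - ((enum_val i).2 j)%:R).
    have := congr1 (fun B : 'rV__ => B 0 j) def_c; rewrite !mxE => ->.
    rewrite [RHS]big_mkcond; apply: eq_bigr => i _.
    by rewrite mxE; case: ifP; rewrite ?mulr0.
  transitivity ((c j *: 'X_[u])@_u').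
    by rewrite mcoeffZ mcoeffX; case: eqP => _; rewrite ?mulr1 ?mulr0.
  rewrite c_rows scaler_suml raddf_sum; apply: eq_bigr => i /andP[/eqP eq_i le].
  rewrite mxE -mulrA gradient_binomial // -scalerAl -scalerAr -mpolyXD submK //.
  by rewrite scalerA.
apply: submod_gen_sum => i /andP[/eqP eq_i _]; apply: submod_gen_scale.
eexists; last by [].
by rewrite /presentation_ideal comp_mpolyB !comp_mnm eq_i subrr.
Qed.

Lemma polar_of_weights v :
  (forall w u, weight_determined w u -> \sum_j w j * sym_coef v j u = 0) ->
  polar_syzygy f v.
Proof.
move=> vw; pose D := (\max_(j < m) msize (v 0%R j * 'X_[a j])%R)%N.
have -> : v = \sum_(u : 'X_{1..n < D}) homogeneous_row (fun j => sym_coef v j u) u.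
  apply: sym_coef_inj => j u'; rewrite {2}/sym_coef summxE mulr_suml raddf_sum /=.
  under eq_bigr => u _.
    rewrite -/(sym_coef _ j u') sym_coef_homogeneous; last exact: lemX_coef.
    over.
  rewrite {1}/sym_coef (mpolywE (k := D) (p := v 0 j * _)) ?leq_bigmax // raddf_sum.
  by apply: eq_bigr => u _; rewrite /= mcoeffZ mcoeffX; case: eqP; rewrite ?mulr1 ?mulr0.
apply: submod_gen_sum => u _; apply: homogeneous_polar => [j|w]; first exact: lemX_coef.
exact: vw.
Qed.

(** Both directions look at a single degree u, in which [homogeneous_row] realizes a
    linear relation c between exponents as a differential syzygy. *)
Theorem polarizableP : polarizable f <->
  forall u w, weight_determined w u -> forall c : 'I_m -> k,
    (forall j, c j != 0 -> (a j <= u)%MM) ->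
    (forall i, \sum_j (a j i)%:R * c j = 0) -> \sum_j w j * c j = 0.
Proof.
split=> [fP u w wu c cu ca|fP v].
  have : polar_syzygy f (homogeneous_row c u).
    apply/fP/diff_syzygyP=> i u'.
    under eq_bigr => j _ do rewrite (sym_coef_homogeneous _ (cu j)).
    have [_|_] := eqVneq u u'; first exact: ca.
    by rewrite big1 // => j _; rewrite mulr0.
  move/(polar_vanish wu).
  by under eq_bigr => j _ do rewrite (sym_coef_homogeneous _ (cu j)) eqxx.
split=> [|vZ]; first exact: polar_diff.
apply: polar_of_weights => w u wu; apply: fP wu _ _ _ => [j|i]; first exact: lemX_coef.
by move/diff_syzygyP: vZ; apply.
Qed.

End MonomialAlgebra.

(** * Bow ties as pairs of closed walks *)

Section BowWalks.
Variable T : finType.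
Implicit Types (x y z : T) (p c A : seq T) (E : {set T}).

Lemma path_of_edges (e : rel T) x p :
  (forall y z, [set y; z] \in path_edges x p -> e y z) -> path e x p.
Proof.
elim: p x => [//|y p IH] x ep /=; rewrite ep ?path_edges_cons ?setU11 //.
by apply: IH => z t zt; apply: ep; rewrite path_edges_cons inE zt orbT.
Qed.

Lemma set1_set2 y x z : [set y] = [set x; z] -> x = y /\ z = y.
Proof. by rewrite -(setUid [set y]) => /set2_eq[] [-> ->]. Qed.

Lemma closed_loop_edge x c y : uniq c -> last x c = x ->
  [set y] \in path_edges x c -> c = [:: y].
Proof.
move=> uc lx /path_edgesP[a [z [b [def_c /set1_set2[ay zy]]]]]; subst z.
case/lastP: a => [|a t] in ay def_c *.
  rewrite /= in ay def_c; subst y c; case: b uc lx => [//|z b] /= /andP[xb _] lx.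
  by case/negP: xb; rewrite -{1}lx mem_last.
move: uc; rewrite last_rcons in ay; rewrite def_c ay cat_uniq.
by case/and3P=> _ /hasPn/(_ y (mem_head _ _)); rewrite /= mem_rcons mem_head.
Qed.

Lemma uniq_no_loop_edge x p y : uniq (x :: p) -> [set y] \notin path_edges x p.
Proof.
move=> up; apply/path_edgesP=> -[a [z [b [def_p /set1_set2[ay zy]]]]]; subst z.
move: up; rewrite def_p -cat_cons cat_uniq.
by case/and3P=> _ /hasPn/(_ y (mem_head _ _)); rewrite /= -ay mem_last.
Qed.

Lemma rotate_to x c : uniq c -> x \in c -> exists o,
  [/\ uniq o, last x o = x, size o = size c, o =i c & path_edges x o = cycle_edges c].
Proof.
move=> uc /rot_to[i c' def_c]; exists (rot 1 (rot i c)).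
have lx : last x (rot 1 (rot i c)) = x by rewrite def_c rot1_cons last_rcons.
split; rewrite ?rot_uniq ?size_rot //; first by move=> y; rewrite !mem_rot.
rewrite -(cycle_edges_closed _ lx) ?rot_uniq //.
rewrite /cycle_edges; apply/setP=> E; apply/imsetP/imsetP=> -[y yc ->];
  exists y; rewrite ?next_rot ?rot_uniq // ?mem_rot //.
by move: yc; rewrite !mem_rot.
Qed.

(** The data of a bow tie with both cycles rotated so that they end on the structural
    path. In contrast to [bow_tie] it treats the degenerate and the non-degenerate
    case together, and it is visibly symmetric in the two cycles. *)
Definition bow_walk x o1 A o2 :=
  [/\ [/\ uniq o1, last x o1 = x & odd (size o1)],
      [/\ uniq o2, last (last x A) o2 = last x A & odd (size o2)],
      uniq (x :: A),
      forall y, y \in o1 -> y \in o2 -> A = [::] /\ y = x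
    & forall y, y \in x :: A -> (y \in o1 -> y = x) /\ (y \in o2 -> y = last x A)].

Definition bow_walk_edges x o1 A o2 :=
  path_edges x o1 :|: path_edges (last x A) o2 :|: path_edges x A.

Lemma rev_back x A : last x A :: back x A = rev (x :: A).
Proof. by rewrite [in RHS]lastI rev_rcons. Qed.

Lemma bow_walk_flip x o1 A o2 :
  bow_walk x o1 A o2 -> bow_walk (last x A) o2 (back x A) o1.
Proof.
case=> c1 c2 uA meet handle; split; rewrite ?last_back //.
- by rewrite rev_back rev_uniq.
- by move=> y y2 y1; have [-> ->] := meet y y1 y2.
by move=> y; rewrite rev_back mem_rev => /handle[].
Qed.

Lemma bow_walk_edges_flip x o1 A o2 :
  bow_walk_edges (last x A) o2 (back x A) o1 = bow_walk_edges x o1 A o2.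
Proof. by rewrite /bow_walk_edges last_back path_edges_back (setUC (path_edges _ o2)). Qed.

Lemma bow_walk_of_bow_tie (B : bow_tie T) :
  exists o1 o2, [/\ bow_walk (bt_start B) o1 (bt_path B) o2,
    size o1 = size (bt_cycle1 B), size o2 = size (bt_cycle2 B),
    edges (bow_tie_graph B) = bow_walk_edges (bt_start B) o1 (bt_path B) o2
  & forall y, (y \in vertices (bow_tie_graph B)) =
      [|| y \in o1, y \in o2 | y \in bt_start B :: bt_path B]].
Proof.
case: B => c1 c2 x A zE odd1 odd2 dis shape /=; rewrite /zE in shape.
have [/andP[u1 s1] /andP[u2 s2]] := (odd1, odd2).
have [x1 z2] : x \in c1 /\ last x A \in c2.
  case: shape => [[_ _ []]//|[-> eqx]] /=.
  by have := eqx x; rewrite eqxx => /andP[].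
have [o1 [uo1 l1 so1 m1 E1]] := rotate_to u1 x1.
have [o2 [uo2 l2 so2 m2 E2]] := rotate_to u2 z2.
exists o1, o2; split=> //=; last first.
- by move=> y; rewrite inE !mem_cat m1 m2.
- by rewrite /bow_walk_edges E1 E2.
split; rewrite ?so1 ?so2 //.
- by case: shape => [[_ []]//|[-> _]].
- move=> y; rewrite m1 m2 => y1 y2; case: shape => [[/pred0P/(_ y)]|[-> eqx]].
    by rewrite /= y1 y2.
  by split=> //; apply/eqP; rewrite -eqx y1 y2.
move=> y yA; rewrite m1 m2; case: shape => [[/pred0P dis12 _ _ ends]|[A0 _]]; last first.
  by move: yA; rewrite A0 inE => /eqP ->.
split=> yc; have := ends y yA; rewrite mem_cat yc ?orbT => /(_ isT)[] // yE.
  by have := dis12 (last x A); rewrite /= z2 -yE yc.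
by have := dis12 x; rewrite /= x1 -yE yc.
Qed.

End BowWalks.

(** * Quadratic monomials and their graph *)

Section QuadraticMonomials.
Variables (k : fieldType) (n m : nat) (a : 'I_m -> 'X_{1..n}).
Variable f : m.-tuple {mpoly k[n]}.
Hypothesis fE : forall j, tnth f j = 'X_[a j].
Hypothesis a_inj : injective a.
Hypothesis a_deg2 : forall j, mdeg (a j) = 2%N.
Hypothesis two_neq0 : (2%:R : k) != 0.
Implicit Types (x y z v : 'I_n) (p : seq 'I_n) (u : 'X_{1..n}) (j : 'I_m).
Local Notation G := (monomial_graph f).

Lemma deg2_split (b : 'X_{1..n}) : mdeg b = 2%N -> exists x y, b = (U_(x) + U_(y))%MM.
Proof.
move=> b2; have [x bx] : exists x, b x != 0%N.
  apply/existsP; apply: contraT; rewrite negb_exists => /forallP b0.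
  by move: b2; rewrite mdegE big1 // => x _; apply/eqP; rewrite -[_ == _]negbK.
have le : (U_(x) <= b)%MM by rewrite lep1mP.
have /mdeg1P[y /eqP def_y] : mdeg (b - U_(x))%MM == 1%N.
  by have := mdegD (b - U_(x)) U_(x); rewrite submK // b2 mdeg1 addn1 => -[<-].
by exists x, y; rewrite addmC -def_y submK.
Qed.

Lemma mnmDU x y z : (U_(x) + U_(y))%MM z = ((x == z) + (y == z))%N.
Proof. by rewrite mnmDE !mnm1E. Qed.

Lemma mpolyX_inj : injective (fun u => 'X_[u] : {mpoly k[n]}).
Proof.
move=> u u' /= /(congr1 (mcoeff u)); rewrite !mcoeffX eqxx.
by case: eqVneq => // _ /eqP; rewrite oner_eq0.
Qed.

Lemma edgeP x y :
  reflect (exists j, a j = (U_(x) + U_(y))%MM) ([set x; y] \in edges G).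
Proof.
apply: (iffP imsetP) => [[[x' y'] /=]|[j aj]]; last first.
  exists (x, y) => //=; rewrite inE /= -mpolyXD -aj -fE; exact: mem_tnth.
rewrite inE /= -mpolyXD => /tnthP[j]; rewrite fE => /mpolyX_inj aj eq_xy.
by exists j; case: (set2_eq eq_xy) => -[-> ->]; rewrite ?aj // addmC.
Qed.

Lemma edge_set2 (E : {set 'I_n}) : E \in edges G -> exists x y, E = [set x; y].
Proof. by case/imsetP=> -[x y] _ ->; exists x, y. Qed.

(** The subgraph whose edges are the f_j dividing x^u. *)
Definition edge_below u : rel 'I_n :=
  [rel x y | [exists j, (a j == (U_(x) + U_(y))%MM) && (a j <= u)%MM]].

Lemma edge_belowP u x y : reflect (exists2 j, a j = (U_(x) + U_(y))%MM & (a j <= u)%MM)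
  (edge_below u x y).
Proof.
apply: (iffP existsP) => [[j /andP[/eqP aj le]]|[j aj le]]; exists j => //.
by rewrite aj eqxx -aj.
Qed.

Lemma edge_below_sym u x y : edge_below u x y = edge_below u y x.
Proof. by rewrite /edge_below /=; apply: eq_existsb => j; rewrite addmC. Qed.

(** The value of F at the edge between x and y. At most one index j contributes, as
    the f_j are distinct; the sum avoids a default index. *)
Definition edge_sum (R : nmodType) (F : 'I_m -> R) x y : R :=
  \sum_(j | a j == (U_(x) + U_(y))%MM) F j.

Lemma edge_sumE (R : nmodType) (F : 'I_m -> R) x y j :
  a j = (U_(x) + U_(y))%MM -> edge_sum F x y = F j.
Proof.
move=> aj; rewrite /edge_sum (big_pred1 j) // => l /=.
by rewrite -aj (inj_eq a_inj).
Qed.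

Lemma edge_sum_sym (R : nmodType) (F : 'I_m -> R) x y : edge_sum F x y = edge_sum F y x.
Proof. by apply: eq_bigl => j; rewrite addmC. Qed.

(** * Good induced bow ties imply polarizability *)

Section Sufficiency.
Variables (u : 'X_{1..n}) (w : 'I_m -> k).
Hypothesis wu : weight_determined a w u.
Local Notation e := (edge_below u).

Definition edge_mnm x y : 'X_{1..m} := (\sum_(j | a j == (U_(x) + U_(y))%MM) U_(j))%MM.

(** Every second edge of the walk, starting with the first one if b holds. For a
    closed even walk the two halves al, be satisfy f^al = f^be. *)
Fixpoint half_walk (b : bool) x p : 'X_{1..m} :=
  if p is y :: p' then
    ((if b then edge_mnm x y else 0) + half_walk (~~ b) y p')%MM
  else 0%MM.

Lemma weightD al be : weight w (al + be)%MM = weight w al + weight w be.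
Proof.
by rewrite /weight -big_split; apply: eq_bigr => j _; rewrite mnmDE natrD mulrDr.
Qed.

Lemma weight0 : weight w 0%MM = 0.
Proof. by rewrite /weight big1 // => j _; rewrite mnm0E mulr0. Qed.

Lemma weightU j : weight w U_(j)%MM = w j.
Proof.
rewrite /weight (bigD1 j) //= mnm1E eqxx mulr1 big1 ?addr0 // => l lj.
by rewrite mnm1E eq_sym (negbTE lj) mulr0.
Qed.

Lemma weight_edge x y : weight w (edge_mnm x y) = edge_sum w x y.
Proof.
rewrite /edge_mnm (big_morph _ weightD weight0).
by apply: eq_bigr => j _; rewrite weightU.
Qed.

Lemma weight_half x p :
  weight w (half_walk true x p) - weight w (half_walk false x p) =
  altsum (edge_sum w) x p.
Proof.
elim: p x => [|y p IH] x /=; first by rewrite subrr.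
by rewrite !weightD weight0 weight_edge -IH /=; ring.
Qed.

Lemma image_mnmD al be : image_mnm a (al + be)%MM = (image_mnm a al + image_mnm a be)%MM.
Proof.
apply/mnmP=> i; rewrite mnmDE !image_mnmE -big_split /=.
by apply: eq_bigr => j _; rewrite mnmDE mulnDr.
Qed.

Lemma image_edge x y : e x y -> image_mnm a (edge_mnm x y) = (U_(x) + U_(y))%MM.
Proof.
case/edge_belowP=> j aj _; rewrite /edge_mnm (big_pred1 j) => [|l]; last first.
  by rewrite -aj (inj_eq a_inj).
apply/mnmP=> i; rewrite image_mnmE (bigD1 j) //= mnm1E eqxx muln1 big1.
  by rewrite addn0 aj.
by move=> l lj; rewrite mnm1E eq_sym (negbTE lj) muln0.
Qed.

(** Each of the two halves covers the vertices of the walk once, except for the two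
    ends, which depend on the parity. *)
Lemma image_half v x p : path e x p ->
  (image_mnm a (half_walk true x p) v + ~~ odd (size p) * (last x p == v) =
     count_mem v (x :: p))%N /\
  (image_mnm a (half_walk false x p) v + (x == v) + odd (size p) * (last x p == v) =
     count_mem v (x :: p))%N.
Proof.
have image0 : image_mnm a 0%MM v = 0%N.
  by rewrite image_mnmE big1 // => j _; rewrite mnm0E muln0.
elim: p x => [|y p IH] x /=; first by rewrite image0 mul1n !addn0.
case/andP=> exy /IH[/= <- IHf]; move: IHf; rewrite !image_mnmD !mnmDE image0 image_edge //.
by rewrite mnmDU negbK; lia.
Qed.

Lemma thin_closed_walk x p : path e x p -> last x p = x -> ~~ odd (size p) ->
  (forall v, count_mem v p <= u v)%N -> altsum (edge_sum w) x p = 0.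
Proof.
move=> ep lx op pu; rewrite -weight_half; apply/eqP; rewrite subr_eq0; apply/eqP.
have imE v : image_mnm a (half_walk true x p) v = count_mem v p /\
    image_mnm a (half_walk false x p) v = count_mem v p.
  by have := image_half v ep; rewrite lx op (negbTE op) /=; lia.
apply: wu; first by apply/mnmP=> v; have [-> ->] := imE v.
by apply/mnm_lepP=> v; have [-> _] := imE v.
Qed.

Hypothesis good : forall B : bow_tie 'I_n,
  induced_subgraph (bow_tie_graph B) G ->
  (monedge B /\ both_loops B) \/ (path_degenerate B /\ looped B).

Lemma induced_of_chordless (B : bow_tie 'I_n) :
  (forall E, E \in edges (bow_tie_graph B) -> exists y z, e y z /\ E = [set y; z]) ->
  (forall y z, y \in vertices (bow_tie_graph B) -> z \in vertices (bow_tie_graph B) ->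
     y != z -> e y z -> [set y; z] \in edges (bow_tie_graph B)) ->
  (forall y, y \in vertices (bow_tie_graph B) -> exists z, e z y) ->
  induced_subgraph (bow_tie_graph B) G.
Proof.
move=> Be Bchord Bvert; pose V := vertices (bow_tie_graph B).
pose L := loops G :\: edges (bow_tie_graph B).
exists (~: V), L; first exact: subsetDl.
have BG E : E \in edges (bow_tie_graph B) -> E \in edges G.
  by case/Be=> y [z [/edge_belowP[j aj _] ->]]; apply/edgeP; exists j.
have -> : bow_tie_graph B = Graph V (edges (bow_tie_graph B)) by [].
rewrite /delete; congr Graph.
  by apply/setP=> y; rewrite !inE andbT negbK.
apply/setP=> E; rewrite /L in_setD [in X in _ = _ && X]inE [in X in _ = ~~ X && _]in_setD.
apply/idP/idP=> [BE|].
  rewrite BE BG //=; apply/pred0P=> y /=; rewrite inE andbC; apply/negbTE.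
  by apply/negP=> /andP[/negP yV yE]; apply: yV; apply: bow_tie_edges_sub BE yE.
case/andP=> noL /andP[GE dis].
have EV y : y \in E -> y \in V.
  by move=> yE; move/pred0P: dis => /(_ y); rewrite /= yE inE => /negbFE.
move: noL; rewrite negb_and negbK => /orP[//|].
rewrite inE GE /= => noloop; have [y [z defE]] := edge_set2 GE.
have yz : y != z by apply: contra noloop => /eqP yz; rewrite defE yz setUid cards1.
have [yV zV] : y \in V /\ z \in V by split; apply: EV; rewrite defE ?set21 ?set22.
rewrite defE; apply: Bchord => //; move: GE; rewrite defE => /edgeP[j aj].
apply/edge_belowP; exists j => //; rewrite aj; apply/mnm_lepP=> i; rewrite mnmDU.
have u_pos v : v \in V -> (0 < u v)%N.
  case/Bvert=> t /edge_belowP[l al /mnm_lepP/(_ v)]; rewrite al mnmDU eqxx.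
  by apply: leq_trans; rewrite addn1.
have [yi|_] := eqVneq y i; have [zi|_] //= := eqVneq z i.
- by case/eqP: yz; rewrite yi zi.
- by rewrite -yi u_pos.
by rewrite -zi u_pos.
Qed.

(** With w(xy) = g(x) + g(y) the pairing of w and c is that of g with the relation
    between exponents. *)
Lemma weight_orthogonal (c : 'I_m -> k) :
  (forall j, c j != 0 -> (a j <= u)%MM) ->
  (forall i, \sum_j (a j i)%:R * c j = 0) -> \sum_j w j * c j = 0.
Proof.
move=> cu ca.
have bal := balanced (edge_below_sym u) (edge_sum_sym w) _ _ thin_closed_walk _.
have [|||g gE] := potential (edge_below_sym u) (edge_sum_sym w) two_neq0
  (fun N => bal _ _ _ N).
- move=> x y /edge_belowP[j aj /mnm_lepP/(_ y)]; rewrite aj mnmDU eqxx.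
  by apply: leq_trans; rewrite addn1.
- by move=> x /edge_belowP[j aj /mnm_lepP/(_ x)]; rewrite aj mnmDU eqxx.
- by move=> B Be Bchord Bvert; apply: good; apply: induced_of_chordless.
have wE j : w j * c j = \sum_i (g i * ((a j i)%:R * c j)).
  have [->|cj] := eqVneq (c j) 0.
    by rewrite mulr0 big1 // => i _; rewrite !mulr0.
  have [x [y aj]] := deg2_split (a_deg2 j).
  rewrite -(edge_sumE w aj) gE; last by apply/edge_belowP; exists j => //; apply: cu.
  under eq_bigr do rewrite mulrA aj mnmDU natrD mulrDr mulrDl.
  rewrite big_split /= mulrDl; congr (_ + _).
    rewrite (bigD1 x) //= eqxx mulr1 big1 ?addr0 // => i.
    by rewrite eq_sym => /negbTE ->; rewrite mulr0 mul0r.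
  rewrite (bigD1 y) //= eqxx mulr1 big1 ?addr0 // => i.
  by rewrite eq_sym => /negbTE ->; rewrite mulr0 mul0r.
under eq_bigr do rewrite wE.
by rewrite exchange_big big1 // => i _; rewrite -mulr_sumr ca mulr0.
Qed.

End Sufficiency.

(** * An induced bow tie that is pinched at a vertex obstructs polarizability *)

(** W1 = v, s, M, v and W2 are odd closed walks which meet in v only and contain all
    edges below u; the side S of v consists of s and M. *)
Section Pinch.
Variables (u : 'X_{1..n}) (v s : 'I_n) (M W2 : seq 'I_n).
Local Notation W1 := (s :: rcons M v).
Local Notation e := (edge_below u).
Hypotheses (eW1 : path e v W1) (M_odd : odd (size M)) (vM : v \notin s :: M).
Hypotheses (eW2 : path e v W2) (lW2 : last v W2 = v) (oddW2 : odd (size W2)).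
Hypothesis meet : forall y, y \in s :: M -> y \notin v :: W2.
Hypothesis cover : forall y z, e y z ->
  [set y; z] \in path_edges v W1 :|: path_edges v W2.
Hypothesis uv1 : u v = 1%N.

Let inS y := y \in s :: M.
Let crossing j := odd (\sum_(y | inS y) a j y).
Let crosses x y := inS x (+) inS y.

Lemma crossingE j x y : a j = (U_(x) + U_(y))%MM -> crossing j = crosses x y.
Proof.
move=> aj; rewrite /crossing aj; under eq_bigr do rewrite mnmDU.
rewrite big_split /= oddD.
suff sumE z : (\sum_(t | inS t) (z == t) = inS z)%N by rewrite !sumE !oddb.
case: (boolP (inS z)) => zS.
  rewrite (bigD1 z) //= eqxx big1 // => t /andP[_].
  by rewrite eq_sym => /negbTE ->.
rewrite big1 // => t tS; apply/eqP; rewrite eqb0.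
by apply: contra zS => /eqP ->.
Qed.

(** An edge leaves the side S only through v. *)
Lemma crossing_at_pinch j : (a j <= u)%MM -> crossing j -> (0 < a j v)%N.
Proof.
move=> le; have [x [y aj]] := deg2_split (a_deg2 j); rewrite (crossingE aj) aj mnmDU.
have : e x y by apply/edge_belowP; exists j.
move/cover; rewrite inE => /orP[] Exy.
  have in1 z : z \in [set x; y] -> (z == v) || inS z.
    move/(path_edges_mem Exy); rewrite -rcons_cons inE mem_rcons inE orbA orbb.
    by [].
  have := in1 _ (set21 x y); have := in1 _ (set22 x y).
  by rewrite /crosses; case: (y == v); case: (x == v) => //= -> ->.
have in2 z : z \in [set x; y] -> inS z = false.
  by move/(path_edges_mem Exy) => zW; apply/negP=> /meet; rewrite zW.
by rewrite /crosses !in2 ?set21 ?set22.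
Qed.

(** The number of crossing edges in T^al is at most u_v = 1, and its parity is that
    of the degree of f^al in the vertices of S. *)
Lemma crossing_determined : weight_determined a (fun j => (crossing j)%:R : k) u.
Proof.
move=> al be eq_ab le.
suff weightE al' : image_mnm a al' = image_mnm a al ->
    (\sum_j crossing j * al' j)%N = odd (\sum_(y | inS y) image_mnm a al y).
  have natE al' : weight (fun j => (crossing j)%:R : k) al' =
      (\sum_j crossing j * al' j)%N%:R.
    by rewrite /weight natr_sum; apply: eq_bigr => j _; rewrite natrM.
  by rewrite !natE !weightE.
move=> eq_al; rewrite -eq_al; rewrite -{}eq_al in le.
have le1 : (\sum_j crossing j * al' j <= 1)%N.
  rewrite -uv1; apply: leq_trans (mnm_lepP le v); rewrite image_mnmE leq_sum // => j _.
  case: (posnP (al' j)) => [->|al0]; first by rewrite !muln0.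
  rewrite leq_mul2r; apply/orP; right; case: (boolP (crossing j)) => // cj.
  apply: crossing_at_pinch cj; apply: lepm_trans le; apply/mnm_lepP=> i.
  rewrite image_mnmE (bigD1 j) //= -[X in (X <= _)%N]muln1.
  by rewrite (leq_trans _ (leq_addr _ _)) // leq_mul2l al0 orbT.
have oddE : odd (\sum_j crossing j * al' j) = odd (\sum_(y | inS y) image_mnm a al' y).
  under [in RHS]eq_bigr do rewrite image_mnmE.
  rewrite exchange_big /= !(big_morph odd oddD (erefl _)).
  by apply: eq_bigr => j _; rewrite -big_distrl /= !oddM oddb.
by rewrite -oddE; case: (\sum_j _)%N le1 => [|[]].
Qed.

Lemma edge_below_uniq j x y : e x y -> a j = (U_(x) + U_(y))%MM -> (a j <= u)%MM.
Proof. by case/edge_belowP=> l al le ->; rewrite -al. Qed.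

(** The alternating relation along W1 and W2 crosses from v to S in the first edge of
    W1 and back in the last one. Both have sign +, since W1 is odd, so the
    crossing weight has the value 2 on it. *)
Lemma pinch_not_polarizable : ~ polarizable f.
Proof.
have a_pos j : (0 < mdeg (a j))%N by rewrite a_deg2.
move=> fP; pose W := W1 ++ W2.
have lW1 : last v W1 = v by rewrite /= last_rcons.
have eW : path e v W by rewrite cat_path eW1 lW1.
pose c j := altsum (fun x y => (a j == (U_(x) + U_(y))%MM)%:R : k) v W.
have sumE (r : 'I_m -> k) : \sum_j r j * c j = altsum (edge_sum r) v W.
  rewrite altsum_sum; apply: (altsum_eq_in _ eW) => x y _.
  rewrite /edge_sum [RHS]big_mkcond; apply: eq_bigr => j _.
  by case: ifP; rewrite ?mulr1 ?mulr0.
have : \sum_j (crossing j)%:R * c j = 0.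
  apply: ((polarizableP fE a_pos).1 fP u _ crossing_determined) => [j|i].
    apply: contraNT => nle; rewrite /c.
    rewrite (altsum_eq_in (h' := fun _ _ => 0) _ eW) ?altsum0 // => x y exy.
    by case: eqP => // /(edge_below_uniq exy); rewrite (negbTE nle).
  rewrite sumE (altsum_eq_in (h' := fun x y => (x == i)%:R + (y == i)%:R) _ eW).
    rewrite (altsum_potential (g := fun x => (x == i)%:R)) // size_cat exprD.
    rewrite last_cat lW1 lW2 !sgP oddW2 /= size_rcons /= M_odd /=.
    by rewrite mulrNN !mul1r subrr.
  by move=> x y /edge_belowP[j aj _]; rewrite (edge_sumE _ aj) aj mnmDU natrD.
have crossE x y : e x y ->
    edge_sum (fun j => (crossing j)%:R : k) x y = (crosses x y)%:R.
  by move=> /edge_belowP[j aj _]; rewrite (edge_sumE _ aj) (crossingE aj).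
rewrite sumE (altsum_eq_in crossE eW) altsum_cat lW1.
have flat x p b : all (fun y => inS y == b) (x :: p) ->
    altsum (fun x y => (crosses x y)%:R : k) x p = 0.
  elim: p x => [//|y p IH] x /= /and3P[/eqP xb /eqP yb pb].
  by rewrite IH /= ?yb ?eqxx // /crosses xb yb addbb subrr.
rewrite (flat v W2 false); last first.
  by apply/allP=> y yW; apply/eqP/negP=> /meet; rewrite yW.
rewrite mulr0 addr0 /= -cats1 altsum_cat (flat s M true); last first.
  by apply/allP=> y yM; apply/eqP.
rewrite -signr_odd M_odd /= subr0 /crosses /inS mem_head (negbTE vM) mem_last /=.
by apply/eqP; rewrite add0r expr1 mulr1 opprK -[1 + 1]/(2%:R).
Qed.

End Pinch.

(** The exponent u is the least common multiple of the edges of the bow tie: all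
    vertices have exponent 1 except the bases of loops, which have exponent 2. *)
Section BowWalkLevel.
Variables (u : 'X_{1..n}) (x : 'I_n) (o1 A o2 : seq 'I_n).
Local Notation E := (bow_walk_edges x o1 A o2).
Hypothesis walk : bow_walk x o1 A o2.
Hypothesis belowE : forall y z, edge_below u y z = ([set y; z] \in E).
Hypothesis uE : forall y,
  u y = ([|| y \in o1, y \in o2 | y \in x :: A] + ([set y] \in E))%N.

Lemma path_below y p : path_edges y p \subset E -> path (edge_below u) y p.
Proof. by move/subsetP=> sub; apply: path_of_edges => z t /sub; rewrite belowE. Qed.

(** If o1 is not a loop, the bow tie is pinched at x, provided that x is not the base of
    the loop o2. *)
Lemma pinch_at_cycle : (size o1 != 1)%N -> A <> [::] \/ (size o2 != 1)%N -> ~ polarizable f.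
Proof.
case: walk => [[u1 l1 s1] [u2 l2 s2] uA meet handle] n1 n2.
have [s [M def1]] : exists s M, o1 = s :: rcons M x.
  case: (o1) l1 s1 n1 => [//|s o] /=; case/lastP: o => [//|M y].
  by rewrite last_rcons => -> _ _; exists s, M.
have xM : x \notin s :: M.
  by move: u1; rewrite def1 -rcons_cons rcons_uniq => /andP[].
apply: (@pinch_not_polarizable u x s M (A ++ o2 ++ back x A)).
- by rewrite -def1; apply: path_below; rewrite /bow_walk_edges -setUA subsetUl.
- by move: s1; rewrite def1 /= size_rcons /= negbK.
- exact: xM.
- rewrite !cat_path l2 !path_below //.
  + by rewrite path_edges_back /bow_walk_edges subsetUr.
  + by rewrite /bow_walk_edges -setUA setUCA subsetUl.
  by rewrite /bow_walk_edges subsetUr.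
- by rewrite !last_cat l2 last_back.
- by rewrite !size_cat size_back !oddD s2; case: odd.
- move=> y yM; have y1 : y \in o1 by rewrite def1 -rcons_cons mem_rcons inE yM orbT.
  have yx : y != x by apply: contraNneq xM => <-.
  rewrite -cat_cons !mem_cat; apply/negP=> /or3P[yA|y2|].
  + by have [/(_ y1)/eqP] := handle y yA; rewrite (negbTE yx).
  + by have [_ /eqP] := meet y y1 y2; rewrite (negbTE yx).
  rewrite mem_rev => /mem_belast yA.
  by have [/(_ y1)/eqP] := handle y yA; rewrite (negbTE yx).
- move=> y z; rewrite belowE -def1 !path_edges_cat l2 path_edges_back !inE.
  by case/orP=> [/orP[]|] ->; rewrite ?orbT.
rewrite uE mem_head !orbT; have /negbTE -> // : [set x] \notin E.
rewrite /bow_walk_edges !inE !negb_or (uniq_no_loop_edge _ uA) andbT; apply/andP; split.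
  by apply/negP=> /(closed_loop_edge u1 l1) def; rewrite def in n1.
apply/negP=> /(closed_loop_edge u2 l2) def2; case: n2 => [An|]; last by rewrite def2.
have x1 : x \in o1 by rewrite def1 -rcons_cons mem_rcons mem_head.
by have [] := meet x x1; rewrite ?def2 ?mem_head.
Qed.

(** A structural path of length at least 2 has an inner vertex v, here its second
    vertex, and v is not the base of a loop of the bow tie. *)
Lemma pinch_in_handle : (1 < size A)%N -> ~ polarizable f.
Proof.
case: walk => [[u1 l1 s1] [u2 l2 s2] uA meet handle] sA.
have [v [A2 [defA A20]]] : exists v A2, A = v :: A2 /\ (0 < size A2)%N.
  by case: (A) sA => [//|v A2]; exists v, A2.
have vA : v \in x :: A by rewrite defA !inE eqxx orbT.
have xA : x \notin A by case/andP: uA.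
have x1 : x \in o1 by case: (o1) l1 s1 => //= t o <- _; rewrite mem_last.
have xv : v != x by apply: contraNneq xA => <-; rewrite defA mem_head.
have v1 : v \notin o1.
  by apply/negP=> v1; have [/(_ v1)/eqP] := handle v vA; rewrite (negbTE xv).
have vA2 : v \notin A2 by move: uA; rewrite defA => /and3P[].
have v2 : v \notin o2.
  apply/negP=> v2; have [_ /(_ v2)] := handle v vA; rewrite defA /= => vl.
  by case: (A2) A20 vA2 vl => [//|w A3] _ /negP vA3 /= vl; apply: vA3; rewrite vl mem_last.
have lA : last x A = last v A2 by rewrite defA.
have Ecat : path_edges x A = [set x; v] |: path_edges v A2.
  by rewrite defA path_edges_cons.
apply: (@pinch_not_polarizable u v x o1 (A2 ++ o2 ++ back v A2)).
- rewrite -cats1 /= cat_path l1 /= !belowE (setUC [set v]) path_below.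
    by rewrite !inE Ecat setU11 !orbT.
  by rewrite /bow_walk_edges -setUA subsetUl.
- exact: s1.
- by rewrite inE negb_or xv.
- rewrite !cat_path -lA l2 lA !path_below //.
  + by rewrite path_edges_back /bow_walk_edges Ecat setUCA setUA subsetUr.
  + by rewrite -lA /bow_walk_edges -setUA setUCA subsetUl.
  by rewrite /bow_walk_edges Ecat setUCA setUA subsetUr.
- by rewrite !last_cat -lA l2 lA last_back.
- by rewrite !size_cat size_back !oddD s2; case: odd.
- move=> y yo; have y1 : y \in o1 by move: yo; rewrite inE => /orP[/eqP ->|//].
  have A2A z : z \in v :: A2 -> z \in A by rewrite defA.
  have yvA : y \notin v :: A2.
    apply/negP=> /A2A yA; have [|/(_ y1) yx _] := handle y; first by rewrite inE yA orbT.
    by rewrite yx (negbTE xA) in yA.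
  rewrite -cat_cons !mem_cat (negbTE yvA) /=; apply/negP=> /orP[y2|].
    by have [] := meet y y1 y2; rewrite defA.
  by rewrite mem_rev => /mem_belast; rewrite (negbTE yvA).
- move=> y z; rewrite belowE -cats1 path_edges_cons !path_edges_cat -lA l2 lA l1.
  rewrite path_edges_back !inE Ecat !inE lA (setUC [set v]).
  by case/orP=> [/orP[]|/orP[]] ->; rewrite ?orbT.
rewrite uE vA !orbT; have /negbTE -> // : [set v] \notin E.
rewrite /bow_walk_edges !inE !negb_or (uniq_no_loop_edge _ uA) andbT.
apply/andP; split; apply/negP.
  by move/(closed_loop_edge u1 l1)=> def; rewrite def mem_head in v1.
by move/(closed_loop_edge u2 l2)=> def; rewrite def mem_head in v2.
Qed.

End BowWalkLevel.

Lemma induced_edge_sub (B : bow_tie 'I_n) E : induced_subgraph (bow_tie_graph B) G ->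
  E \in edges (bow_tie_graph B) -> E \in edges G.
Proof. by case=> D [L _ ->]; rewrite !inE => /andP[_ /andP[]]. Qed.

Lemma induced_chord (B : bow_tie 'I_n) y z : induced_subgraph (bow_tie_graph B) G ->
  y \in vertices (bow_tie_graph B) -> z \in vertices (bow_tie_graph B) -> y != z ->
  [set y; z] \in edges G -> [set y; z] \in edges (bow_tie_graph B).
Proof.
case=> D [L /subsetP subL ->]; rewrite !inE !andbT => yD zD yz GE.
rewrite GE /=; apply/andP; split.
  by apply/negP=> /subL; rewrite inE cards2 yz andbF.
by apply/pred0P=> t /=; apply/negbTE/negP=> /andP[/set2P[]->]; apply/negP.
Qed.

(** A bow tie that is not of one of the two types has a vertex at which it is
    pinched: an end of the structural path lying on a cycle that is not a loop,
    or an inner vertex of the path. *)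
Lemma induced_good (B : bow_tie 'I_n) : polarizable f ->
  induced_subgraph (bow_tie_graph B) G ->
  (monedge B /\ both_loops B) \/ (path_degenerate B /\ looped B).
Proof.
move=> fP ind; have [o1 [o2 [walk so1 so2 edgesE vertsE]]] := bow_walk_of_bow_tie B.
rewrite /monedge /both_loops /path_degenerate /looped /is_loop -so1 -so2.
pose V := vertices (bow_tie_graph B); pose E := edges (bow_tie_graph B).
pose u : 'X_{1..n} := [multinom ((y \in V) + ([set y] \in E))%N | y < n].
have belowE y z : edge_below u y z = ([set y; z] \in E).
  apply/edge_belowP/idP=> [[j aj /mnm_lepP le]|yzE].
    have GE : [set y; z] \in edges G by apply/edgeP; exists j.
    have inV t : (0 < a j t)%N -> t \in V.
      move/leq_trans/(_ (le t)); rewrite mnmE; case: (boolP (t \in V)) => //= nV.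
      by rewrite add0n lt0b => tE; rewrite -(negbTE nV) (bow_tie_edges_sub tE) ?set11.
    have [yz|yz] := eqVneq y z; last first.
      by apply: induced_chord => //; apply: inV; rewrite aj mnmDU eqxx ?addn1.
    have := le y; rewrite aj -yz mnmDU mnmE eqxx.
    by rewrite setUid; case: (_ \in E); rewrite ?addn0 //; case: (_ \in V).
  have /edgeP[j aj] := induced_edge_sub ind yzE; exists j => //.
  have [yV zV] : y \in V /\ z \in V.
    by split; apply: bow_tie_edges_sub yzE _; rewrite ?set21 ?set22.
  apply/mnm_lepP=> i; rewrite aj mnmDU mnmE.
  have [yi|_] := eqVneq y i; have [zi|_] //= := eqVneq z i.
  - by move: yzE yV; rewrite yi zi setUid => -> ->.
  - by rewrite -yi yV.
  by rewrite -zi zV.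
rewrite /E edgesE in belowE.
have uE y : u y = ([|| y \in o1, y \in o2 | y \in bt_start B :: bt_path B] +
    ([set y] \in bow_walk_edges (bt_start B) o1 (bt_path B) o2))%N.
  by rewrite mnmE /V vertsE /E edgesE.
have flipE : bow_walk_edges (last (bt_start B) (bt_path B)) o2
    (back (bt_start B) (bt_path B)) o1 = bow_walk_edges (bt_start B) o1 (bt_path B) o2.
  exact: bow_walk_edges_flip.
have pinch1 := pinch_at_cycle walk belowE uE.
have pinch2 : (size o2 != 1)%N -> bt_path B <> [::] \/ (size o1 != 1)%N -> ~ polarizable f.
  move=> n2 n1; apply: (pinch_at_cycle (bow_walk_flip walk)) n2 _.
  - by move=> y z; rewrite flipE.
  - by move=> y; rewrite flipE uE rev_back mem_rev orbCA.
  case: n1 => [An|]; [left | by right].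
  by move=> /(congr1 size); rewrite size_back => /size0nil.
have pinch3 := pinch_in_handle walk belowE uE.
case: (bt_path B) pinch1 pinch2 pinch3 => [|y [|z p]] pinch1 pinch2 pinch3.
- right; split=> //; have [n1|n1] := eqVneq (size o1) 1%N; first by left.
  have [n2|n2] := eqVneq (size o2) 1%N; first by right.
  by case: pinch1 => //; right.
- left; split=> //; split; apply: contraT => n12; [case: pinch1 | case: pinch2] => //;
    by left.
by case: pinch3.
Qed.

Lemma simple_graphP : simple_graph G <-> forall j i, (a j i <= 1)%N.
Proof.
split=> [simple j i|sqf].
  rewrite leqNgt; apply/negP=> aji; have [x [y aj]] := deg2_split (a_deg2 j).
  have [xi yi] : x = i /\ y = i.
    by move: aji; rewrite aj mnmDU; do 2!case: eqP.
  have : [set i; i] \in loops G.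
    rewrite inE setUid cards1 eqxx andbT -[[set i]]setUid; apply/edgeP; exists j.
    by rewrite aj xi yi.
  by rewrite simple inE.
apply/setP=> E; rewrite !inE; apply/negbTE/negP=> /andP[GE /cards1P[i defE]].
move: GE; rewrite defE -(setUid [set i]) => /edgeP[j aj].
by have := sqf j i; rewrite aj mnmDU eqxx.
Qed.

Lemma squarefreeP : (forall g, g \in f -> squarefree_monomial g) <->
  forall j i, (a j i <= 1)%N.
Proof.
split=> [sqf j i|sqf g /tnthP[j ->]]; last by exists (a j).
have [mu mu1] := sqf _ (mem_tnth j f); rewrite fE => /mpolyX_inj ->.
exact: mu1.
Qed.

Lemma simple_induced_not_looped (B : bow_tie 'I_n) : simple_graph G ->
  induced_subgraph (bow_tie_graph B) G -> ~ looped B.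
Proof.
move=> simple ind loop; suff [x xE] : exists x, [set x] \in edges (bow_tie_graph B).
  have : [set x] \in loops G by rewrite inE (induced_edge_sub ind xE) cards1.
  by rewrite simple inE.
have loop_edge c : is_loop c -> exists x : 'I_n, [set x] \in cycle_edges c.
  case: c => [|x [|]] // _; exists x; apply/imsetP; exists x; rewrite ?mem_head //.
  by rewrite /= eqxx setUid.
by case: loop => /loop_edge[x xE]; exists x; rewrite !inE xE ?orbT.
Qed.

Lemma polarizable_iff_bow_ties : polarizable f <->
  forall B : bow_tie 'I_n, induced_subgraph (bow_tie_graph B) G ->
    (monedge B /\ both_loops B) \/ (path_degenerate B /\ looped B).
Proof.
split=> [fP B|good]; first exact: induced_good.
have a_pos j : (0 < mdeg (a j))%N by rewrite a_deg2.
apply/(polarizableP fE a_pos) => u w wu c cu ca.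
exact: (weight_orthogonal wu good cu ca).
Qed.

End QuadraticMonomials.

Local Close Scope ring_scope.

Theorem theorem4p14 (k : fieldType) (char0 : [pchar k]%R =i pred0) (n m : nat)
    (f : m.-tuple {mpoly k[n]}) (f_distinct : uniq f)
    (f_deg2 : forall g, g \in f -> monomial_of_degree 2 g) :
  (polarizable f <->
     forall B : bow_tie 'I_n,
       induced_subgraph (bow_tie_graph B) (monomial_graph f) ->
       (monedge B /\ both_loops B) \/ (path_degenerate B /\ looped B))
  /\ ((forall g, g \in f -> squarefree_monomial g) <->
        simple_graph (monomial_graph f))
  /\ ((forall g, g \in f -> squarefree_monomial g) ->
        (polarizable f <->
           ~ exists B : bow_tie 'I_n,
               induced_subgraph (bow_tie_graph B) (monomial_graph f))).
Proof.
have two_neq0 : (2%:R != 0 :> k)%R by rewrite (pcharf0P k).1.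
have /fin_all_exists2[a a_deg2 fE] :
    forall j, exists2 mu : 'X_{1..n}, mdeg mu = 2%N & tnth f j = 'X_[mu]%R.
  by move=> j; apply: f_deg2; apply: mem_tnth.
have a_inj : injective a.
  move=> i j eq_a; apply: (tuple_uniqP f f_distinct); rewrite !fE eq_a //.
have iffP := polarizable_iff_bow_ties fE a_inj a_deg2 two_neq0.
have sqfP := squarefreeP fE; have simpleP := simple_graphP fE a_deg2.
split=> //; split; first by rewrite sqfP simpleP.
rewrite sqfP -simpleP => simple; rewrite iffP; split=> [good [B ind]|noB B ind].
  apply: (simple_induced_not_looped simple ind).
  by case: (good B ind) => [[_ []]|[]] //; left.
by case: noB; exists B.
Qed.
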